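(* Let $X$ and $Y$ be represented spaces and let $f:\subseteq X\rightrightarrows Y$ be a problem. Then the following are equivalent: (1) $f:\subseteq X\rightrightarrows Y$ is limit computable; (2) $f$, considered as a problem $f:\subseteq X\rightrightarrows Y'$, is computable; (3) $f$, considered as a problem $f:\subseteq X_{\mathsf{J}}\rightrightarrows Y$, is computable.
   Context: $F:\subseteq A\to B$ denotes a partial function, $f:\subseteq A\rightrightarrows B$ a partial multi-valued function (nonempty values on its domain). A representation of a set $X$ is a surjective partial function $\delta_X:\subseteq\mathbb{N}^{\mathbb{N}}\to X$; $(X,\delta_X)$ is then a represented space. A problem is a partial multi-valued function $f:\subseteq X\rightrightarrows Y$ between represented spaces. $F:\subseteq\mathbb{N}^{\mathbb{N}}\to\mathbb{N}^{\mathbb{N}}$ is a realizer of $f$ if $\delta_YF(p)\in f\delta_X(p)$ for all $p\in\mathrm{dom}(f\delta_X)$. A problem is computable (limit computable) if it has a realizer with that property. A partial function $F:\subseteq\mathbb{N}^{\mathbb{N}}\to\mathbb{N}^{\mathbb{N}}$ is computable if there is a Turing machine (infinite input tape, one-way output tape) that on each $p\in\mathrm{dom}(F)$ produces $F(p)$ in the long run; it is limit computable if there is a Turing machine with a two-way output tape (it may revise its output) that on each $p\in\mathrm{dom}(F)$ computes $F(p)$ such that each output position $n$ has, after finitely many steps, the content $F(p)(n)$ and is never changed again. Nothing is required outside $\mathrm{dom}(F)$. With $\langle n,k\rangle:=\frac12(n+k)(n+k+1)+k$ and $\langle p_0,p_1,\dots\rangle\langle n,k\rangle:=p_n(k)$,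 let $\lim:\subseteq\mathbb{N}^{\mathbb{N}}\to\mathbb{N}^{\mathbb{N}}$, $\langle p_0,p_1,\dots\rangle\mapsto\lim_{i\to\infty}p_i$ (product topology). The Turing jump $\mathsf{J}:\mathbb{N}^{\mathbb{N}}\to\mathbb{N}^{\mathbb{N}}$ is given by $\mathsf{J}(p)(i)=1$ if the $i$-th Turing machine halts upon input $p$, and $0$ otherwise; it is injective with partial inverse $\mathsf{J}^{-1}$. For a represented space $(X,\delta_X)$: $X'$ is the set $X$ with representation $\delta_X\circ\lim$, and $X_{\mathsf{J}}$ is the set $X$ with representation $\delta_X\circ\mathsf{J}^{-1}$. *)

(* Defs.v *)
From mathcomp Require Import all_boot zify.
From mathcomp Require Import all_classical topology function_spaces separation_axioms.

Set Implicit Arguments.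
Unset Strict Implicit.
Unset Printing Implicit Defensive.

Local Open Scope classical_set_scope.

(* Partial functions are single-valued relations, so that they need not have
   a decidable domain. *)
Record pfun (A B : Type) := PFun {
  graph :> A -> B -> Prop;
  graph_fun : forall a b b', graph a b -> graph a b' -> b = b' }.

Program Definition pcomp (A B C : Type) (g : pfun B C) (f : pfun A B) :
    pfun A C :=
  @PFun A C (fun a c => exists2 b, f a b & g b c) _.
Next Obligation.
move=> A B C g f a c c' [b fab gbc] [b' fab' gbc'].
by move: gbc'; rewrite -(graph_fun fab fab'); exact: graph_fun.
Qed.

Notation baire := {ptws nat -> nat}.

Record rep_space := RepSpace {
  carrier :> Type;
  rep : pfun baire carrier;
  rep_surj : forall x, exists p, rep p x }.

(* A problem f : X ==> Y is a function f : X -> set Y; its domain is the set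
   of the x such that f x is nonempty. *)
Definition realizes (X Y : rep_space) (f : X -> set Y)
    (F : pfun baire baire) : Prop :=
  forall p x, rep X p x -> f x !=set0 ->
    exists q y, [/\ F p q, rep Y q y & f x y].

(* A machine with k work tapes has k.+2 tapes: tape ord0 is the read-only
   input tape and tape ord_max is the output tape.  All tapes are infinite to
   the right; moving left at cell 0 has no effect.  States and tape symbols are
   natural numbers, of which a table mentions only finitely many; 0 is the
   initial state and also the blank symbol. *)
Inductive move := Left | Stay | Right.

Definition rule (k : nat) : Type :=
  ((nat * k.+2.-tuple nat) * (nat * k.+2.-tuple (nat * move)))%type.

(* The rule ((s, reads), (s', acts)) applies in state s when the symbols under
   the heads are reads; it leads to state s', and acts gives, for each tape,
   the symbol to be written and the subsequent move of the head.  The first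
   applicable rule is used, and the machine halts if there is none. *)
Record machine := Machine {
  work_tapes : nat;
  table : seq (rule work_tapes) }.

Record config (k : nat) := Config {
  state : nat;
  head : 'I_k.+2 -> nat;
  tape : 'I_k.+2 -> nat -> nat }.

Definition move_head (d : move) (h : nat) : nat :=
  match d with Left => h.-1 | Stay => h | Right => h.+1 end.

Definition scan (k : nat) (c : config k) : k.+2.-tuple nat :=
  [tuple tape c j (head c j) | j < k.+2].

Definition act (k : nat) (s : nat) (acts : k.+2.-tuple (nat * move))
    (c : config k) : config k :=
  Config s
    (fun j => move_head (tnth acts j).2 (head c j))
    (fun j i => if (j != ord0) && (i == head c j) then (tnth acts j).1
                else tape c j i).

Definition step (M : machine) (c : config (work_tapes M)) :
    option (config (work_tapes M)) :=
  if [seq r.2 | r <- table M & r.1 == (state c, scan c)] is (s, acts) :: _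
  then Some (act s acts c) else None.

(* Sequences of natural numbers are written on tapes in unary: the content of
   the tape is 1^(p 0) 2 1^(p 1) 2 1^(p 2) 2 and so on. *)
Definition unary (p : baire) (i : nat) : nat :=
  if [exists n : 'I_i.+1, i == n + \sum_(m < n.+1) p m] then 2 else 1.

Definition init (k : nat) (p : baire) : config k :=
  Config 0 (fun=> 0) (fun j i => if j == ord0 then unary p i else 0).

Definition run (M : machine) (p : baire) (t : nat) : config (work_tapes M) :=
  iter t (fun c => odflt c (step c)) (init (work_tapes M) p).

Definition halts (M : machine) (p : baire) : Prop :=
  exists t, step (run M p t) = None.

Definition out_head (M : machine) (p : baire) (t : nat) : nat :=
  head (run M p t) ord_max.

Definition out (M : machine) (p : baire) (t i : nat) : nat :=
  tape (run M p t) ord_max i.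

Definition one_way (M : machine) : bool :=
  all (fun r : rule (work_tapes M) =>
         if (tnth r.2.2 ord_max).2 is Left then false else true) (table M).

(* On a one-way output tape, the cells behind the head are final. *)
Definition computable_fun (F : pfun baire baire) : Prop :=
  exists2 M, one_way M &
    forall p q, F p q ->
      forall i, exists2 t, i < out_head M p t & out M p t i = unary q i.

(* Here the output head may also move left and revise the output. *)
Definition limit_computable_fun (F : pfun baire baire) : Prop :=
  exists M, forall p q, F p q ->
    forall i, exists t0, forall t, t0 <= t -> out M p t i = unary q i.

Definition computable (X Y : rep_space) (f : X -> set Y) : Prop :=
  exists2 F, computable_fun F & realizes f F.

Definition limit_computable (X Y : rep_space) (f : X -> set Y) : Prop :=
  exists2 F, limit_computable_fun F & realizes f F.

Definition decode_move (n : nat) : move :=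
  match n with 0 => Stay | 1 => Left | _ => Right end.

(* A rule is coded by the list consisting of its two states followed by, for
   each tape, the symbol read, the symbol written and the move. *)
Definition decode_rule (k : nat) (s : seq nat) : rule k :=
  ((nth 0 s 0, [tuple nth 0 s (3 * j + 2) | j < k.+2]),
   (nth 0 s 1,
    [tuple (nth 0 s (3 * j + 3), decode_move (nth 0 s (3 * j + 4))) | j < k.+2])).

(* CodeSeq.decode is a bijection from nat to seq nat. *)
Definition nth_machine (i : nat) : machine :=
  let s := CodeSeq.decode i in
  @Machine (seq.head 0 s)
    [seq decode_rule _ (CodeSeq.decode c) | c <- behead s].

Definition turing_jump (p : baire) : baire :=
  fun i => if `[< halts (nth_machine i) p >] then 1 else 0.

Lemma nth_machine_surj (M : machine) : exists i, nth_machine i = M.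
Proof.
pose code_move d := match d with Stay => 0 | Left => 1 | Right => 2 end.
case: M => k T.
pose code_rule (r : rule k) := [:: r.1.1, r.2.1 &
  flatten [seq [:: tnth r.1.2 j; (tnth r.2.2 j).1; code_move (tnth r.2.2 j).2]
          | j <- enum 'I_k.+2]].
have code_ruleE (r : rule k) (j : 'I_k.+2) l : l < 3 ->
    nth 0 (code_rule r) (3 * j + l.+2) =
    nth 0 [:: tnth r.1.2 j; (tnth r.2.2 j).1; code_move (tnth r.2.2 j).2] l.
  move=> l3; rewrite addnS addnS /code_rule /=.
  pose g (j : 'I_k.+2) :=
    [:: tnth r.1.2 j; (tnth r.2.2 j).1; code_move (tnth r.2.2 j).2].
  have gen (e : seq 'I_k.+2) a : a < size e ->
      nth 0 (flatten (map g e)) (3 * a + l) = nth 0 (g (nth j e a)) l.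
    elim: e a => [//|x e IH] [|a] ha.
      by rewrite muln0 add0n; case: (l) l3 => [|[|[|]]].
    by rewrite (_ : 3 * a.+1 + l = (3 * a + l).+3); [exact: IH | lia].
  by rewrite gen ?size_enum_ord// nth_ord_enum.
have code_rule01 r : nth 0 (code_rule r) 0 = r.1.1 /\
  nth 0 (code_rule r) 1 = r.2.1 by [].
clearbody code_rule.
exists (CodeSeq.code (k :: [seq CodeSeq.code (code_rule r) | r <- T])).
rewrite /nth_machine CodeSeq.codeK /=; congr Machine.
rewrite -map_comp -[RHS]map_id; apply: eq_map => r.
rewrite /= CodeSeq.codeK /decode_rule; case: (code_rule01 r) => -> ->.
case: r (code_ruleE r) => -[s rd] [s' ac] E /=.
congr ((_, _), (_, _)); apply: eq_from_tnth => j; rewrite tnth_mktuple.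
  exact: (E j 0).
rewrite (E j 1)// (E j 2)//=.
by case: (tnth ac j) => w [].
Qed.

Definition cantor_pair (n k : nat) : nat := ((n + k) * (n + k + 1)) %/ 2 + k.

(* The n-th component of the sequence <p_0, p_1, ...> coded by p. *)
Definition component (p : baire) (n : nat) : baire :=
  fun k => p (cantor_pair n k).

Program Definition limit : pfun baire baire :=
  @PFun baire baire (fun p q => component p n @[n --> \oo] --> q) _.
Next Obligation.
move=> p q q' pq pq'; apply: cvg_unique pq pq'.
apply: hausdorff_product => _; exact: discrete_hausdorff.
Qed.

Lemma cantor_pair_inj n k n' k' :
  cantor_pair n k = cantor_pair n' k' -> n = n' /\ k = k'.
Proof.
pose tri s := (s * (s + 1)) %/ 2.
have triS s : tri s.+1 = tri s + s.+1.
  rewrite /tri; have -> : s.+1 * (s.+1 + 1) = s.+1 * 2 + s * (s + 1) by lia.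
  by rewrite divnMDl// addnC.
have tri_le s d : tri s <= tri (s + d).
  by elim: d => [|d IH]; rewrite ?addn0// addnS triS; lia.
rewrite /cantor_pair -/(tri (n + k)) -/(tri (n' + k')).
clearbody tri.
case: (ltngtP (n + k) (n' + k')) => [lt|lt|eq]; last by rewrite eq; lia.
- have := tri_le (n + k).+1 (n' + k' - (n + k).+1).
  by rewrite subnKC// triS; lia.
- have := tri_le (n' + k').+1 (n + k - (n' + k').+1).
  by rewrite subnKC// triS; lia.
Qed.

Lemma limit_surj (q : baire) : exists p, limit p q.
Proof.
pose snd_of m := xget 0 [set k | exists n, cantor_pair n k = m].
exists (fun m => q (snd_of m)) => /=.
rewrite (_ : component _ = fun=> q); first exact: cvg_cst.
apply/funext => n; apply/funext => k; rewrite /component; congr q.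
rewrite /snd_of; case: xgetP => [j _ [n' /cantor_pair_inj[]//]|/(_ k)].
by case; exists n.
Qed.

Lemma unary_inj : injective unary.
Proof.
pose pos (p : baire) n := n + \sum_(m < n.+1) p m.
have posS p n : pos p n.+1 = (pos p n + p n.+1).+1.
  by rewrite /pos (big_ord_recr n.+1)/=; lia.
have pos_lt p : {homo pos p : m n / m < n}.
  by apply: homo_ltn => [? ? ?|n]; [exact: ltn_trans | rewrite posS; lia].
have unaryP p i : (unary p i == 2) = `[< exists n, i = pos p n >].
  rewrite /unary; apply/idP/asboolP => [|[n ->]].
    by case: existsP => // -[n /eqP ->] _; exists n.
  have le_n : n < (pos p n).+1 by rewrite ltnS leq_addr.
  by case: existsP => // -[]; exists (Ordinal le_n); apply/eqP.
have pos_le p q : unary p = unary q -> forall n, pos q n <= pos p n.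
  move=> pq; elim=> [|n IH].
    have /asboolP[k ->] : `[< exists k, pos p 0 = pos q k >].
      by rewrite -unaryP -pq unaryP; apply/asboolP; exists 0.
    by case: k => [//|k]; apply: ltnW; apply: pos_lt.
  have /asboolP[k Ek] : `[< exists k, pos p n.+1 = pos q k >].
    by rewrite -unaryP -pq unaryP; apply/asboolP; exists n.+1.
  have lt_nk : n < k.
    rewrite ltnNge; apply/negP => le_kn.
    have : pos q k <= pos q n.
      by move: le_kn; rewrite leq_eqVlt => /predU1P[->//|/pos_lt/ltnW].
    by have := pos_lt p n n.+1 (ltnSn n); lia.
  rewrite Ek; move: lt_nk; rewrite leq_eqVlt => /predU1P[->//|/pos_lt/ltnW//].
move=> p q pq; have Epos n : pos p n = pos q n.
  by apply/eqP; rewrite eqn_leq !pos_le.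
apply/funext => -[|n].
  by have := Epos 0; rewrite /pos !big_ord1 !add0n.
by have := Epos n.+1; rewrite !posS Epos; lia.
Qed.

(* A machine that halts if and only if the i-th input cell contains 1. *)
Lemma halts_at (i : nat) : exists M, forall p, halts M p <-> unary p i = 1.
Proof.
pose R s t' d t : rule 0 :=
  ((t, [tuple of [:: s; 0]]), (t', [tuple of [:: (s, d); (0, Stay)]])).
pose M := @Machine 0 (R 2 i Stay i ::
  [seq R 1 t.+1 Right t | t <- iota 0 i] ++
  [seq R 2 t.+1 Right t | t <- iota 0 i]).
have keyE s t' d t u v :
    ((R s t' d t).1 == (u, [tuple of [:: v; 0]])) = (t == u) && (s == v).
  by rewrite xpair_eqE -val_eqE /= eqseq_cons andbT.
have lookE u v : (v == 1) || (v == 2) ->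
    [seq r.2 | r <- table M & r.1 == (u, [tuple of [:: v; 0]])] =
    if u < i then [:: (R v u.+1 Right u).2]
    else if (u == i) && (v == 2) then [:: (R 2 i Stay i).2] else [::].
  move=> v12.
  have mapE s : [seq r.2 | r <- [seq R s t.+1 Right t | t <- iota 0 i]
                         & r.1 == (u, [tuple of [:: v; 0]])] =
      if (u < i) && (s == v) then [:: (R s u.+1 Right u).2] else [::].
    rewrite filter_map -map_comp.
    rewrite (eq_filter (a2 := fun t => (t == u) && (s == v))); last first.
      by move=> t; exact: keyE.
    case: (s == v); last first.
      by rewrite andbF (eq_filter (a2 := pred0)) ?filter_pred0// => t; rewrite andbF.
    rewrite andbT (eq_filter (a2 := pred1 u)) => [|t]; last by rewrite andbT.
    case: ltnP => ui.
      by rewrite filter_pred1_uniq ?iota_uniq// mem_iota.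
    by rewrite (eq_in_filter (a2 := pred0)) ?filter_pred0// => t;
      rewrite mem_iota /= => ?; apply/negbTE/eqP; lia.
  have headE : [seq r <- [:: R 2 i Stay i] | r.1 == (u, [tuple of [:: v; 0]])] =
      if (u == i) && (v == 2) then [:: R 2 i Stay i] else [::].
    by rewrite (eq_sym u) (eq_sym v) -(keyE 2 i Stay).
  rewrite [table M](_ : _ = [:: R 2 i Stay i] ++
    ([seq R 1 t.+1 Right t | t <- iota 0 i] ++
     [seq R 2 t.+1 Right t | t <- iota 0 i]))//.
  rewrite !filter_cat !map_cat !mapE headE.
  by case/orP: v12 => /eqP ->; case: (ltngtP u i).
exists M => p.
have unary12 j : (unary p j == 1) || (unary p j == 2).
  by rewrite /unary; case: ifP.
pose good (c : config 0) := [/\ tape c ord0 = unary p,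
  head c ord0 = state c & forall h, tape c ord_max h = 0].
have scanE (c : config 0) : good c ->
    scan c = [tuple of [:: unary p (state c); 0]].
  case=> c0 hc c1; apply: eq_from_tnth => j; rewrite tnth_mktuple.
  case: j => -[|[|//]] lj; rewrite (tnth_nth 0)/=.
    by rewrite (_ : Ordinal lj = ord0) ?c0 ?hc//; exact: val_inj.
  by rewrite (_ : Ordinal lj = ord_max) ?c1//; exact: val_inj.
have good_act (c : config 0) s v d : good c -> move_head d (state c) = s ->
    good (act s [tuple of [:: (v, d); (0, Stay)]] c).
  move=> [c0 hc c1] ds; split; rewrite /act /=.
  - by rewrite c0.
  - by rewrite hc.
  - by move=> h; case: ifP.
have lt_step (c : config 0) : good c -> state c < i ->
    exists2 c', @step M c = Some c' & good c' /\ state c' = (state c).+1.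
  move=> gc lt_ci; rewrite /step (scanE _ gc) (lookE _ _ (unary12 _)) lt_ci.
  by eexists; [reflexivity | split => //; exact: good_act].
have eq_step (c : config 0) : good c -> state c = i ->
    if unary p i == 1 then @step M c = None
    else exists2 c', @step M c = Some c' & good c' /\ state c' = i.
  move=> gc ci; rewrite /step (scanE _ gc) (lookE _ _ (unary12 _)) ci ltnn eqxx.
  case/orP: (unary12 i) => /eqP -> //=.
  by eexists; [reflexivity | split => //; exact: good_act].
have runS t : run M p t.+1 = odflt (run M p t) (step (run M p t)) by [].
have lt_run t : t <= i -> good (run M p t) /\ state (run M p t) = t.
  elim: t => [_|t IH lt_ti]; first by split => //; split.
  have [gt st] := IH (ltnW lt_ti); rewrite runS.
  have [|c' -> [gc' sc']] := lt_step _ gt; first by rewrite st.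
  by split => //=; rewrite sc' st.
split=> [[t stop]|pi1]; last first.
  exists i; have [gi si] := lt_run _ (leqnn i).
  by have := eq_step _ gi si; rewrite pi1.
apply/eqP; apply/negPn/negP => pi1.
have ge_run u : good (run M p (u + i)) /\ state (run M p (u + i)) = i.
  elim: u => [|u [gu su]]; first exact: lt_run.
  rewrite addSn runS.
  by have := eq_step _ gu su; rewrite (negbTE pi1) => -[c' -> //].
have [lt_ti|le_it] := ltnP t i.
  have [gt st] := lt_run _ (ltnW lt_ti).
  by have [|c'] := lt_step _ gt; rewrite ?st// stop.
have [] := ge_run (t - i); rewrite subnK// => gt st.
by have := eq_step _ gt st; rewrite (negbTE pi1) stop => -[].
Qed.

Lemma turing_jump_inj : injective turing_jump.
Proof.
move=> p q Jpq; apply: unary_inj; apply/funext => i.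
have [M MP] := halts_at i; have [n nM] := nth_machine_surj M.
have : halts M p <-> halts M q.
  have := congr1 (@^~ n) Jpq; rewrite /turing_jump nM.
  by case: asboolP; case: asboolP.
rewrite !MP /unary; case: ifP => _; case: ifP => _ // -[].
  by move=> _ /(_ erefl).
by move=> /(_ erefl).
Qed.

Definition jump_inv : pfun baire baire :=
  @PFun baire baire (fun q p => turing_jump p = q)
    (fun q p p' e e' => turing_jump_inj (etrans e (esym e'))).

Program Definition lim_space (X : rep_space) : rep_space :=
  @RepSpace X (pcomp (rep X) limit) _.
Next Obligation.
move=> X x; have [q qx] := rep_surj x; have [p pq] := limit_surj q.
by exists p, q.
Qed.

Program Definition jump_space (X : rep_space) : rep_space :=
  @RepSpace X (pcomp (rep X) jump_inv) _.
Next Obligation.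
move=> X x; have [q qx] := rep_surj x.
by exists (turing_jump q), q.
Qed.

(* Main.v *)
Require Import Defs.
From mathcomp Require Import all_boot.
From mathcomp Require Import all_classical topology.
From mathcomp Require Import zify.

Set Implicit Arguments.
Unset Strict Implicit.
Unset Printing Implicit Defensive.

Local Open Scope classical_set_scope.

(* Each of the three conditions amounts to the existence of a function c,
   primitive recursive in the input p, such that c p n i converges for n -> oo to
   the i-th cell of the unary code of the output.
   - A limit machine provides c by simulation for n steps; conversely c is
     written to the output tape over and over again.
   - The entries that are decoded from c p n form a sequence converging to the
     output; conversely the last complete component of the output for Y' is read
     off.
   - Given the jump of p, one asks whether cell i of c p n stays constant from
     stage t on, until the answer is yes; conversely a machine on the jump is fed
     with the bits that record which machines halt within n steps.
   The simulations need a universal machine, and the questions to the jump need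
   machines whose index is computable from (i, t). *)

(** The obstacle is that machines are concrete tables, so each machine, and for the jump even its
    index, has to be constructed. One program serves for all of them: for n = 0, 1, 2, ... it
    evaluates a primitive recursive value [phi p m n], performs it as an output action and stops at
    the first value that is no action. One-way output, revisable output and semi-decision are three
    uses of this single loop. Primitive recursion suffices because an unbounded search is spread
    over the stages n, with action 0 for waiting; it is also wanted, because every stage has to
    terminate, even on inputs outside the domain and on guesses of the jump that are the jump of no
    input. The approximations concern cells of the unary code rather than entries because a cell has
    only two possible values. Both can be put to the jump in turn, so that the stage of stability is
    the only unbounded search. Nothing is lost, as an entry is determined by the finitely many cells
    up to its separator. *)

Definition upd (f : nat -> nat) (r v : nat) : nat -> nat :=
  fun x => if x == r then v else f x.

(** * Counter programs on Turing machines *)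

(* Register [r] is the position of the head on tape [r.+1], whose cell 0 alone
   carries the mark 1; [olog] lists the output actions performed so far. *)
Record cstate := CState { regs : nat -> nat; ihead : nat; olog : seq nat }.

Inductive instr :=
  | IInc of nat | IDec of nat & nat | IJump of nat
  | IIn of move | ITest of nat | IOut of nat.

(* Output actions: 1 and 2 write that symbol and move right, 3 moves left, and 0
   does nothing. *)
Definition osym (v a : nat) : nat := if (v == 1) || (v == 2) then v else a.

Definition omove (v : nat) : move :=
  match v with 0 => Stay | 1 | 2 => Right | _ => Left end.

Definition emit (o : nat * (nat -> nat)) (v : nat) : nat * (nat -> nat) :=
  (move_head (omove v) o.1,
   fun i => if i == o.1 then osym v (o.2 i) else o.2 i).

Definition emits (l : seq nat) : nat * (nat -> nat) := foldl emit (0, fun=> 0) l.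

Definition instr_step (p : baire) (P : seq instr) (x : nat * cstate) : option (nat *
  cstate) :=
  let: (pc, s) := x in
  match onth P pc with
  | None => None
  | Some (IInc r) =>
      Some (pc.+1, CState (upd (regs s) r (regs s r).+1) (ihead s) (olog s))
  | Some (IDec r l) =>
      Some (if regs s r is n.+1
            then (pc.+1, CState (upd (regs s) r n) (ihead s) (olog s)) else (l, s))
  | Some (IJump l) => Some (l, s)
  | Some (IIn d) =>
      Some (pc.+1, CState (regs s) (move_head d (ihead s)) (olog s))
  | Some (ITest l) => Some (if unary p (ihead s) == 1 then pc.+1 else l, s)
  | Some (IOut v) => Some (pc.+1, CState (regs s) (ihead s) (rcons (olog s) v))
  end.

(** The mark makes the zero test local: a register head reads 1 exactly when it stands on cell 0.
    Every tape except the output tape is written back unchanged. *)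
Definition trans (k : nat) (ins : instr) (pc : nat) (rd : nat -> nat) :
    nat * (nat -> nat * move) :=
  let only i a j := if j == i then a else (rd j, Stay) in
  match ins with
  | IInc r => (pc.+1, only r.+1 (rd r.+1, Right))
  | IDec r l => if rd r.+1 == 1 then (l, fun j => (rd j, Stay))
                else (pc.+1, only r.+1 (rd r.+1, Left))
  | IJump l => (l, fun j => (rd j, Stay))
  | IIn d => (pc.+1, only 0 (rd 0, d))
  | ITest l => (if rd 0 == 1 then pc.+1 else l, fun j => (rd j, Stay))
  | IOut v => (pc.+1, only k.+1 (osym v (rd k.+1), omove v))
  end.

(** With [b] false no output action moves left, which yields one-way machines. A jump to [S], the
    size of the program, is a jump to the exit. *)
Definition wf_instr (b : bool) (k S : nat) (ins : instr) : bool :=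
  match ins with
  | IInc r => r < k
  | IDec r l => (r < k) && (l <= S)
  | IJump l | ITest l => l <= S
  | IIn _ => true
  | IOut v => b || (v < 3)
  end.

Definition head_at (k : nat) (s : cstate) (j : nat) : nat :=
  if j == 0 then ihead s else if j == k.+1 then (emits (olog s)).1
  else regs s j.-1.

Definition tape_at (k : nat) (p : baire) (s : cstate) (j i : nat) : nat :=
  if j == 0 then unary p i else if j == k.+1 then (emits (olog s)).2 i
  else (i == 0).

Definition encode (k : nat) (p : baire) (q : nat) (s : cstate) : config k :=
  Config q (fun j => head_at k s j) (fun j => tape_at k p s j).

Definition scanned (k : nat) (p : baire) (s : cstate) (j : nat) : nat :=
  tape_at k p s j (head_at k s j).

Lemma emits_rcons l v : emits (rcons l v) = emit (emits l) v.
Proof. by rewrite /emits -cats1 foldl_cat. Qed.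

Lemma trans_ext b k S ins pc rd rd' : wf_instr b k S ins ->
  (forall j, j < k.+2 -> rd j = rd' j) ->
  (trans k ins pc rd).1 = (trans k ins pc rd').1 /\
  forall j, j < k.+2 -> (trans k ins pc rd).2 j = (trans k ins pc rd').2 j.
Proof.
move=> wf E; case: ins wf => [r|r l|l|d|l|v] /= wf.
- by split=> // j jk; rewrite !E //; lia.
- rewrite E; last by lia.
  by case: ifP => _; split=> //= j jk; rewrite !E //; lia.
- by split=> // j jk; rewrite !E.
- by split=> // j jk; rewrite !E.
- by rewrite E; split=> // j jk; rewrite !E.
- by split=> // j jk; rewrite !E.
Qed.


Lemma act_encode k p q q' s s' (tr : nat -> nat * move) :
  (forall j, j < k.+2 -> move_head (tr j).2 (head_at k s j) = head_at k s' j) ->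
  (forall j i, 0 < j < k.+2 ->
     (if i == head_at k s j then (tr j).1 else tape_at k p s j i) =
       tape_at k p s' j i) ->
  act q' [tuple tr j | j < k.+2] (encode k p q s) = encode k p q' s'.
Proof.
move=> Hh Ht; rewrite /act /encode; congr Config; apply/funext => j.
  by rewrite tnth_mktuple Hh.
apply/funext => i; rewrite tnth_mktuple /=.
case: (eqVneq j ord0) => [->//|j0] /=; apply: Ht.
by rewrite ltn_ord andbT lt0n; move: j0; rewrite -val_eqE.
Qed.

Lemma keep_scanned k p s j i :
  (if i == head_at k s j then scanned k p s j else tape_at k p s j i) =
    tape_at k p s j i.
Proof. by rewrite /scanned; case: eqP => // ->. Qed.

Lemma act_trans b k S p P q q' pc s ins pc' s' :
  onth P pc = Some ins -> wf_instr b k S ins ->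
  instr_step p P (pc, s) = Some (pc', s') ->
  (trans k ins pc (scanned k p s)).1 = pc' /\
  act q' [tuple (trans k ins pc (scanned k p s)).2 j | j < k.+2] (encode k p q s) =
  encode k p q' s'.
Proof.
rewrite /instr_step => -> wf.
have keep2 j i j' (x : nat * move) : (j == j' -> x.1 = scanned k p s j) ->
    (if i == head_at k s j then
       (if j == j' then x else (scanned k p s j, Stay)).1 else tape_at k p s j i)
    = tape_at k p s j i.
  by case: eqP => [_ /(_ isT) ->|_ _]; rewrite keep_scanned.
have scr r : r < k -> scanned k p s r.+1 = (regs s r == 0).
  by move=> rk; rewrite /scanned /tape_at /head_at /= eqSS ltn_eqF.
have sc0 : scanned k p s 0 = unary p (ihead s) by [].
have H s1 := @act_encode k p q q' s s1 (trans k ins pc (scanned k p s)).2.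
case: ins wf H => [r|r l|l|d|l|v] /= wf H.
- case=> <- <-; split=> //; apply: H => [j jk|j i jk].
    case: (eqVneq j r.+1) => [->|jr]; rewrite /head_at /upd /=.
      by rewrite eqSS ltn_eqF ?eqxx.
    by case: j jr {jk} => [|j] //=; rewrite eqSS => /negbTE->.
  by rewrite keep2 // => /eqP->.
- case/andP: wf => rk _; rewrite scr // in H *; case E: (regs s r) H => [|n] /= H.
    by case=> <- <-; split=> //; apply: H => // j i jk; exact: keep_scanned.
  case=> <- <-; split=> //; apply: H => [j jk|j i jk].
    case: (eqVneq j r.+1) => [->|jr]; rewrite /head_at /upd /=.
      by rewrite eqSS ltn_eqF ?eqxx //= E.
    by case: j jr {jk} => [|j] //=; rewrite eqSS => /negbTE->.
  by rewrite keep2 // => /eqP->; rewrite scr // E.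
- by case=> <- <-; split=> //; apply: H => // j i jk; exact: keep_scanned.
- case=> <- <-; split=> //; apply: H => [j jk|j i jk].
    by rewrite /head_at /=; case: eqP.
  by rewrite keep2 // => /eqP->.
- rewrite sc0 in H *; case=> <- <-; split=> //; apply: H => // j i jk;
  exact: keep_scanned.
- case=> <- <-; split=> //; apply: H => [j jk|j i jk].
    rewrite /head_at /= emits_rcons; case: (eqVneq j k.+1) => [->|jr] //=.
  rewrite /tape_at /= emits_rcons /=; case: (eqVneq j k.+1) => [->|jr] /=.
    by rewrite /scanned /tape_at /head_at /= eqxx; case: eqP => // ->.
  have := keep_scanned k p s j i; rewrite /tape_at /= (negbTE jr); by case: (j) jk.
Qed.

Lemma instr_step_bound b k S p P x y : all (wf_instr b k S) P -> S = size P ->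
  instr_step p P x = Some y -> y.1 <= S.
Proof.
case: x => pc s wf SP; rewrite /instr_step; case E: (onth P pc) => [ins|//].
have pcS : pc < S by rewrite SP -onthTE E.
have : wf_instr b k S ins.
  by move: E wf; elim: (P) (pc) => [|a Q IH] [|n] //= => [[->] /andP[]|/IH h /andP[_]].
case: ins {E} => [r|r l|l|d|l|v] /= wfi [<-] //=.
- by case: (regs s r) => //=; lia.
- by case: ifP.
Qed.

(** * Rule tables and codes of machines *)

Definition code_move (d : move) : nat :=
  match d with Stay => 0 | Left => 1 | Right => 2 end.

(** Rules are kept in the list form that [decode_rule] reads, since the index of the machine is
    later computed from these lists. *)
Definition mkrule (k q q' : nat) (rd : nat -> nat) (tr : nat -> nat * move) :
    seq nat :=
  [:: q, q' & mkseq (fun l => if l %% 3 == 0 then rd (l %/ 3)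
      else if l %% 3 == 1 then (tr (l %/ 3)).1
      else code_move (tr (l %/ 3)).2) (3 * k.+2)].

Lemma decode_mkrule k q q' rd tr : decode_rule k (mkrule k q q' rd tr) =
  ((q, [tuple rd j | j < k.+2]), (q', [tuple tr j | j < k.+2])).
Proof.
have nthE (j : 'I_k.+2) l : l < 3 -> nth 0 (mkrule k q q' rd tr) (3 * j + l.+2) =
    if l == 0 then rd j else if l == 1 then (tr j).1 else code_move (tr j).2.
  move=> l3; rewrite /mkrule !addnS [LHS]/=.
  have jk : 3 * j + l < 3 * k.+2 by have := ltn_ord j; lia.
  rewrite nth_mkseq //.
  have -> : (3 * j + l) %% 3 = l by rewrite mulnC modnMDl modn_small.
  by rewrite mulnC divnMDl // divn_small // addn0.
rewrite /decode_rule; congr ((_, _), (_, _)); apply: eq_from_tnth => j;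
  rewrite !tnth_mktuple.
  exact: (nthE j 0).
rewrite (nthE j 1) // (nthE j 2) //=.
by case: (tr j) => w [].
Qed.

Definition list_machine (k : nat) (ls : seq (seq nat)) : machine :=
  @Machine k (map (decode_rule k) ls).

Lemma nth_machine_code k ls :
  nth_machine (CodeSeq.code (k :: map CodeSeq.code ls)) = list_machine k ls.
Proof.
rewrite /nth_machine CodeSeq.codeK /=; congr Machine.
by rewrite -map_comp; apply: eq_map => l /=; rewrite CodeSeq.codeK.
Qed.

Definition lookup (k : nat) (ls : seq (seq nat)) (key : nat * k.+2.-tuple nat) :=
  [seq r.2 | r <- map (decode_rule k) ls & r.1 == key].

Lemma lookup_cat k ls1 ls2 key : @lookup k (ls1 ++ ls2) key =
  lookup ls1 key ++ lookup ls2 key.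
Proof. by rewrite /lookup map_cat filter_cat map_cat. Qed.

Lemma lookup_none k ls key :
  all (fun l => nth 0 l 0 != key.1) ls -> @lookup k ls key = [::].
Proof.
elim: ls => //= l ls IH /andP[lk /IH]; rewrite /lookup /=.
by case: key lk {IH} => q t /= lk; rewrite xpair_eqE (negbTE lk).
Qed.

Lemma lookup_map k (A : eqType) (f : A -> seq nat) (L : seq A) x key : x \in L ->
  (forall y, y \in L -> ((decode_rule k (f y)).1 == key) = (y == x)) ->
  exists rest, lookup (map f L) key = (decode_rule k (f x)).2 :: rest.
Proof.
move=> xL keyE; rewrite /lookup -map_comp filter_map -map_comp.
rewrite (eq_in_filter (a2 := pred1 x)); last by move=> y yL /=; rewrite keyE.
have : x \in [seq y <- L | pred1 x y] by rewrite mem_filter /= eqxx.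
have : all (pred1 x) [seq y <- L | pred1 x y] by apply/allP=> y;
  rewrite mem_filter => /andP[].
case: [seq y <- L | pred1 x y] => //= y l /andP[/eqP -> _] _.
by exists [seq (decode_rule k (f i)).2 | i <- l].
Qed.

Lemma step_list_machine k ls c : @step (list_machine k ls) c =
  if lookup ls (state c, scan c) is (s, acts) :: _ then Some (act s acts c) else None.
Proof. by []. Qed.

(** Only the symbols 0, 1 and 2 ever occur, so finitely many combinations cover all configurations
    that arise. *)
Definition reads (k : nat) : seq (k.+2.-tuple nat) :=
  [seq [tuple of map val t] | t : k.+2.-tuple 'I_3].

Lemma mem_reads k (t : k.+2.-tuple nat) :
  (forall j, tnth t j < 3) -> t \in reads k.
Proof.
move=> t3; apply/codomP; exists [tuple inord (tnth t j) | j < k.+2].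
by apply: eq_from_tnth => j; rewrite tnth_map tnth_mktuple /= inordK.
Qed.

Definition prog_rule (k : nat) (P : seq instr) (x : nat * k.+2.-tuple nat) :=
  let S := size P in
  let tr := trans k (nth (IJump 0) P x.1) x.1 (nth 0 x.2) in
  mkrule k (S.+1 - x.1) (S.+1 - tr.1) (nth 0 x.2) tr.2.

Lemma decode_prog_rule k P (x : nat * k.+2.-tuple nat) :
  let tr := trans k (nth (IJump 0) P x.1) x.1 (nth 0 x.2) in
  decode_rule k (prog_rule P x) =
  (((size P).+1 - x.1, [tuple nth 0 x.2 j | j < k.+2]),
   ((size P).+1 - tr.1, [tuple tr.2 j | j < k.+2])).
Proof. exact: decode_mkrule. Qed.

Definition prog_rules (k : nat) (P : seq instr) : seq (seq nat) :=
  [seq prog_rule P x | x <- [seq (pc, t) | pc <- iota 0 (size P), t <- reads k]].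

(* A program of size [S] at instruction [pc] is in state [S.+1 - pc], so that 1 is
   the exit state.  State 0 writes the marks and jumps to [S.+1 + m]; the states
   above [S.+1] count down to [S.+1] and thereby load [m] into register 0.  As
   only these rules depend on [m], the index of the machine is primitive
   recursive in [m]. *)
Definition init_rules (k S m : nat) : seq (seq nat) :=
  [seq mkrule k 0 (S.+1 + m) (fun j => if j == 0 then a else 0)
     (fun j => (if (j == 0) || (j == k.+1) then 0 else 1, Stay)) | a <- [:: 1; 2]].

(** During the countdown only two symbols vary: the input cell under the head, and that of register
    0, which is the mark at first and blank after the first increment. The other registers still
    stand on their marks. *)
Definition chain_read (k : nat) (x : nat * nat) (j : nat) : nat :=
  if j == 0 then x.1 else if j == 1 then x.2 else if j == k.+1 then 0 else 1.

Definition chain_rule (k S i : nat) (x : nat * nat) : seq nat :=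
  mkrule k (S.+2 + i) (S.+1 + i) (chain_read k x)
     (fun j => (chain_read k x j, if j == 1 then Right else Stay)).

Definition chain_keys := [:: (1, 0); (1, 1); (2, 0); (2, 1)].

(** New rules go in front, so that the code of the longer chain arises from that of the shorter one
    by prefixing four entries. *)
Fixpoint chain (k : nat) (P : seq instr) (m : nat) : seq (seq nat) :=
  if m is i.+1 then map (chain_rule k (size P) i) chain_keys ++ chain k P i
  else prog_rules k P.

Lemma chainS k P m : chain k P m.+1 =
  map (chain_rule k (size P) m) chain_keys ++ chain k P m.
Proof. by []. Qed.

Definition param_machine (k : nat) (P : seq instr) (m : nat) : machine :=
  list_machine k (init_rules k (size P) m ++ chain k P m).

Lemma unary12 p i : unary p i = 1 \/ unary p i = 2.
Proof. by rewrite /unary; case: ifP; auto. Qed.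

Lemma emits_lt3 l i : (emits l).2 i < 3.
Proof.
elim/last_ind: l i => [|l v IH] i //; rewrite emits_rcons /=.
case: eqP => // _; rewrite /osym.
by case: eqP => [->//|_]; case: eqP => [->//|_] /=.
Qed.

Lemma scanned_lt3 k p s j : scanned k p s j < 3.
Proof.
rewrite /scanned /tape_at; case: eqP => _; first by case: (unary12 p (head_at k s j))
  => ->.
by case: eqP => _; [exact: emits_lt3 | case: eqP].
Qed.

Lemma scan_encode k p q s : scan (encode k p q s) = [tuple scanned k p s j | j < k.+2].
Proof. by apply: eq_from_tnth => j; rewrite !tnth_mktuple. Qed.

Lemma lookup_init k S m key : key.1 != 0 -> @lookup k (init_rules k S m) key = [::].
Proof. by move=> k0; apply: lookup_none; rewrite /= !(eq_sym 0) k0. Qed.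

Lemma lookup_chain k P m i key : key.1 = (size P).+2 + i -> i < m ->
  exists rest, @lookup k (chain k P m) key =
    lookup (map (chain_rule k (size P) i) chain_keys) key ++ rest.
Proof.
move=> keyE; elim: m => // m IH; rewrite ltnS leq_eqVlt => /predU1P[->|im].
  by rewrite chainS lookup_cat; eexists.
rewrite chainS lookup_cat lookup_none; first exact: IH.
rewrite all_map; apply/allP => x _; rewrite /= keyE; apply/eqP; lia.
Qed.

Lemma lookup_chain0 k P m key : key.1 <= (size P).+1 ->
  @lookup k (chain k P m) key = lookup (prog_rules k P) key.
Proof.
move=> keyE; elim: m => // m IH; rewrite chainS lookup_cat IH lookup_none //.
rewrite all_map; apply/allP => x _ /=; apply/eqP; lia.
Qed.

Lemma lookup_prog k P pc (t : k.+2.-tuple nat) : pc < size P ->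
  (forall j, tnth t j < 3) ->
  let tr := trans k (nth (IJump 0) P pc) pc (nth 0 t) in
  exists rest, lookup (prog_rules k P) ((size P).+1 - pc, t) =
    ((size P).+1 - tr.1, [tuple tr.2 j | j < k.+2]) :: rest.
Proof.
move=> pcS t3 tr.
have nthE (u : k.+2.-tuple nat) : [tuple nth 0 u j | j < k.+2] = u.
  by apply: eq_from_tnth => j; rewrite tnth_mktuple -tnth_nth.
pose L := [seq (pc, t) | pc <- iota 0 (size P), t <- reads k].
have xL : (pc, t) \in L by apply: allpairs_f; rewrite ?mem_iota ?mem_reads.
have keyE y : y \in L -> ((decode_rule k (prog_rule P y)).1 ==
    ((size P).+1 - pc, t)) = (y == (pc, t)).
  case/allpairsP=> -[pc' t'] [+ _ ->]; rewrite mem_iota => pc'S.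
  rewrite decode_prog_rule [nth 0 _]/= !xpair_eqE nthE; congr andb.
  by rewrite /= in pc'S *; apply/eqP/eqP; lia.
have [rest E] := lookup_map xL keyE.
by exists rest; rewrite E decode_prog_rule.
Qed.

Definition encode_pc k p (P : seq instr) (x : nat * cstate) :=
  encode k p ((size P).+1 - x.1) x.2.

Lemma step_encode b k P m p x : all (wf_instr b k (size P)) P -> x.1 <= size P ->
  @step (param_machine k P m) (encode_pc k p P x) =
    omap (encode_pc k p P) (instr_step p P x).
Proof.
case: x => pc s wf; rewrite [_.1]/= => pcS; rewrite step_list_machine scan_encode
  lookup_cat lookup_init; last first.
  by rewrite /=; apply/eqP; lia.
rewrite lookup_chain0; last by rewrite /=; lia.
(* At the exit the state is 1, whereas the rules of the program have states of at least 2; hence the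
   machine halts. *)
move: pcS; rewrite leq_eqVlt => /predU1P[->|pcS].
  rewrite /instr_step onth_default // lookup_none //= all_map; apply/allP => -[pc' t].
  by case/allpairsP=> -[? ?] [+ _ [-> _]]; rewrite mem_iota /= => ?; apply/eqP; lia.
have [|rest ->] := lookup_prog pcS (t := [tuple scanned k p s j | j < k.+2]).
  by move=> j; rewrite tnth_mktuple scanned_lt3.
have [ins E] : exists ins, onth P pc = Some ins.
  by case: (onth P pc) (onthTE P pc) => [ins|]; [exists ins | rewrite pcS].
have -> : nth (IJump 0) P pc = ins by rewrite -odflt_onth E.
have wfi : wf_instr b k (size P) ins.
  by move: E wf; elim: (P) (pc) {pcS rest} (size P) => [|a Q IH] [|n] N //=;
    [case=> -> /andP[] | move/IH=> h /andP[_]; apply: h].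
have [y Ey] : exists y, instr_step p P (pc, s) = Some y.
  by rewrite /instr_step E; case: (ins) => *; eexists.
rewrite Ey; case: y Ey => pc' s' Ey.
have rdE j : j < k.+2 -> nth 0 [tuple scanned k p s j | j < k.+2] j = scanned k p s j.
  by move=> jk; rewrite -(tnth_nth _ _ (Ordinal jk)) tnth_mktuple.
have [e1 e2] := trans_ext pc wfi rdE.
have [e3 e4] := act_trans ((size P).+1 - pc) ((size P).+1 - pc') E wfi Ey.
have eT : [tuple (trans k ins pc (nth 0 [tuple scanned k p s j | j < k.+2])).2 j | j
  < k.+2]
    = [tuple (trans k ins pc (scanned k p s)).2 j | j < k.+2] :> k.+2.-tuple (nat *
      move).
  by apply: eq_from_tnth => j; rewrite !tnth_mktuple e2.
by rewrite e1 e3 [omap _ _]/= /encode_pc -e4 eT.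
Qed.

Definition instr_next p P (x : nat * cstate) : nat * cstate :=
  odflt x (instr_step p P x).

Definition param_st (m : nat) : cstate := CState (upd (fun=> 0) 0 m) 0 [::].

Lemma step_init k P m p : @step (param_machine k P m) (init k p) =
  Some (encode k p ((size P).+1 + m) (param_st 0)).
Proof.
rewrite step_list_machine.
have scanE : scan (init k p) = [tuple if (j : nat) ==
  0 then unary p 0 else 0 | j < k.+2].
  by apply: eq_from_tnth => j; rewrite !tnth_mktuple.
rewrite scanE lookup_cat [state _]/=.
pose tr (j : nat) : nat * move := (if (j == 0) || (j == k.+1) then 0 else 1, Stay).
have [rest ->] : exists rest, @lookup k (init_rules k (size P) m)
    (0, [tuple if (j : nat) == 0 then unary p 0 else 0 | j < k.+2]) =
    ((size P).+1 + m, [tuple tr j | j < k.+2]) :: rest.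
  pose R a := mkrule k 0 ((size P).+1 + m) (fun j => if j == 0 then a else 0) tr.
  have keyE a : ((decode_rule k (R a)).1 ==
     (0, [tuple if (j : nat) == 0 then unary p 0 else 0 | j < k.+2])) = (a ==
       unary p 0).
    rewrite decode_mkrule xpair_eqE /=; apply/eqP/eqP => [|->//].
    by move/(congr1 (fun t => tnth t ord0)); rewrite !tnth_mktuple.
  have [||rest ->] := @lookup_map k _ R [:: 1; 2] (unary p 0) (0, [tuple if (j : nat)
    == 0 then unary p 0 else 0 | j < k.+2]).
  - by case: (unary12 p 0) => ->.
  - by move=> y _; rewrite keyE.
  by exists rest; rewrite decode_mkrule.
rewrite /=; congr Some; rewrite /act /encode; congr Config; apply/funext => j.
  rewrite tnth_mktuple /= /head_at /upd /=; case: ifP => // _; case: ifP => // _.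
  by rewrite /upd; case: (j.-1 == 0).
apply/funext => i; rewrite tnth_mktuple /= /tape_at /=.
rewrite -val_eqE /=; case: eqP => //= j0; case: eqP => /=.
  by case: ifP.
by case: eqP.
Qed.

Lemma step_chain k P m p i x : i < m -> 0 < k ->
  @step (param_machine k P m) (encode k p ((size P).+2 + i) (param_st x)) =
  Some (encode k p ((size P).+1 + i) (param_st x.+1)).
Proof.
move=> im k0; rewrite step_list_machine scan_encode lookup_cat lookup_init //.
set key := (X in lookup _ X).
have [|rest ->] := @lookup_chain k P m i key _ im; first by [].
pose z := (unary p 0, (x == 0) : nat).
have scE : [tuple scanned k p (param_st x) j | j < k.+2] =
  [tuple chain_read k z j | j < k.+2].
  apply: eq_from_tnth => j; rewrite !tnth_mktuple /scanned /tape_at /head_at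
    /chain_read /=.
  case: eqP => // j0; case: (eqVneq (nat_of_ord j) k.+1) => [->|j1];
    first by rewrite eqSS gtn_eqF.
  by rewrite /upd; case: (nat_of_ord j) j0 => [|[|]].
have [||rest' ->] := @lookup_map k _ (chain_rule k (size P) i) chain_keys z key.
- by rewrite /chain_keys /z; case: (unary12 p 0) => ->; case: (x == 0).
- move=> y _; rewrite decode_mkrule /key scE xpair_eqE eqxx /=; apply/eqP/eqP =>
  [|->//].
  have k1 : 1 < k.+2 by lia.
  move=> E; have := congr1 (fun t => tnth t ord0) E.
  have := congr1 (fun t => tnth t (Ordinal k1)) E.
  by rewrite !tnth_mktuple /chain_read /=; case: (y) => ? ? /= -> ->.
rewrite decode_mkrule /=; congr Some.
have rE j : j < k.+2 -> chain_read k z j = scanned k p (param_st x) j.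
  by move=> jk; have := congr1 (fun t => tnth t (Ordinal jk)) scE;
    rewrite !tnth_mktuple.
apply: (@act_encode k p _ _ (param_st x) (param_st x.+1) (fun j =>
  (chain_read k z j, if j == 1 then Right else Stay))).
  move=> j jk; rewrite /head_at /= /upd; case: (eqVneq j 1) => [->|j1] /=.
    by rewrite eqSS ltn_eqF.
  by case: j j1 {jk} => [|[|j]] /=.
move=> j l /andP[j0 jk] /=; rewrite rE // keep_scanned.
by [].
Qed.

Lemma runS M p t : run M p t.+1 = odflt (run M p t) (step (run M p t)).
Proof. by []. Qed.

(** The offset [m.+1] is one step for writing the marks and [m] steps for loading register 0; then
    each instruction takes one step. *)
Lemma run_param b k P m p : 0 < k -> all (wf_instr b k (size P)) P ->
  (forall t, t <= m.+1 -> out_head (param_machine k P m) p t = 0 /\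
     forall i, out (param_machine k P m) p t i = 0) /\
  forall t, run (param_machine k P m) p (m.+1 + t) =
    encode_pc k p P (iter t (instr_next p P) (0, param_st m)).
Proof.
move=> k0 wf; set M := param_machine k P m.
have chainE i : i <= m -> run M p i.+1 = encode k p ((size P).+1 + (m - i)) (param_st
  i).
  elim: i => [_|i IH im]; first by rewrite runS step_init subn0.
  rewrite runS IH ?(ltnW im) // (_ : (size P).+1 + (m - i) =
    (size P).+2 + (m - i.+1)); last by lia.
  by rewrite step_chain //=; lia.
split=> [[_|t]|t].
- by [].
- rewrite ltnS => tm; rewrite /out_head /out chainE //= /head_at /tape_at /= eqxx.
  by split=> // i.
suff H : run M p (m.+1 + t) = encode_pc k p P (iter t (instr_next p P) (0, param_st
  m)) /\
   (iter t (instr_next p P) (0, param_st m)).1 <= size P by case: H.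
elim: t => [|t [IH le]].
  by rewrite addn0 chainE // subnn addn0 /encode_pc subn0.
rewrite addnS runS IH (step_encode _ _ wf) // iterS /instr_next.
case E: (instr_step p P _) => [y|] //=; split=> //.
exact: (instr_step_bound wf erefl E).
Qed.

(** * Structured commands and their compilation *)

Inductive cmd :=
  | CSkip | CInc of nat | CIn of move | COut of nat
  | CSeq of cmd & cmd | CLoop of nat & cmd
  | CIf of nat & cmd & cmd | CTest of cmd & cmd.

Fixpoint clen (c : cmd) : nat :=
  match c with
  | CSkip => 0
  | CInc _ | CIn _ | COut _ => 1
  | CSeq c1 c2 => clen c1 + clen c2
  | CLoop _ c1 => (clen c1).+2
  | CIf _ c1 c2 | CTest c1 c2 => (clen c1 + clen c2).+2
  end.

Fixpoint compile (c : cmd) (a : nat) : seq instr :=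
  match c with
  | CSkip => [::]
  | CInc r => [:: IInc r]
  | CIn d => [:: IIn d]
  | COut v => [:: IOut v]
  | CSeq c1 c2 => compile c1 a ++ compile c2 (a + clen c1)
  | CLoop r c1 =>
      IDec r (a + (clen c1).+2) :: rcons (compile c1 a.+1) (IJump a)
  | CIf r c1 c2 => IDec r (a + (clen c1).+2) ::
      (compile c1 a.+1 ++ IJump (a + (clen c1 + clen c2).+2) ::
       compile c2 (a + (clen c1).+2))
  | CTest c1 c2 => ITest (a + (clen c1).+2) ::
      (compile c1 a.+1 ++ IJump (a + (clen c1 + clen c2).+2) ::
       compile c2 (a + (clen c1).+2))
  end.

(** Only terminating runs are derivable. The main loop, which may go on forever, is instead followed
    round by round with [reach_loop]. *)
Inductive exec (p : baire) : cmd -> cstate -> cstate -> Prop :=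
  | ESkip s : exec p CSkip s s
  | EInc r f h l : exec p (CInc r) (CState f h l) (CState (upd f r (f r).+1) h l)
  | EIn d f h l : exec p (CIn d) (CState f h l) (CState f (move_head d h) l)
  | EOut v f h l : exec p (COut v) (CState f h l) (CState f h (rcons l v))
  | ESeq c1 c2 s s1 s2 : exec p c1 s s1 -> exec p c2 s1 s2 ->
      exec p (CSeq c1 c2) s s2
  | ELoop0 r c s : regs s r = 0 -> exec p (CLoop r c) s s
  | ELoopS r c f h l n s1 s2 : f r = n.+1 ->
      exec p c (CState (upd f r n) h l) s1 -> exec p (CLoop r c) s1 s2 ->
      exec p (CLoop r c) (CState f h l) s2
  | EIf0 r c1 c2 s s1 : regs s r = 0 -> exec p c2 s s1 ->
      exec p (CIf r c1 c2) s s1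
  | EIfS r c1 c2 f h l n s1 : f r = n.+1 ->
      exec p c1 (CState (upd f r n) h l) s1 -> exec p (CIf r c1 c2) (CState f h l) s1
  | ETest1 c1 c2 s s1 : unary p (ihead s) = 1 -> exec p c1 s s1 ->
      exec p (CTest c1 c2) s s1
  | ETest2 c1 c2 s s1 : unary p (ihead s) = 2 -> exec p c2 s s1 ->
      exec p (CTest c1 c2) s s1.

Lemma size_compile c a : size (compile c a) = clen c.
Proof.
elim: c a => //= [c1 IH1 c2 IH2|r c IH|r c1 IH1 c2 IH2|c1 IH1 c2 IH2] a.
- by rewrite size_cat IH1 IH2.
- by rewrite size_rcons IH.
- by rewrite size_cat /= IH1 IH2 addnS.
- by rewrite size_cat /= IH1 IH2 addnS.
Qed.

Definition reach p P (x y : nat * cstate) : Prop :=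
  exists n, iter n (instr_next p P) x = y.

Lemma reach_refl p P x : reach p P x x. Proof. by exists 0. Qed.

Lemma reach_trans p P y x z : reach p P x y -> reach p P y z -> reach p P x z.
Proof. by move=> [n <-] [m <-]; exists (m + n); rewrite iterD. Qed.

Lemma reach1 p P x y z : instr_step p P x = Some y -> reach p P y z -> reach p P x z.
Proof.
move=> xy; apply: reach_trans; exists 1; by rewrite /= /instr_next xy.
Qed.

Lemma onth_size (P1 P2 : seq instr) i n : n = size P1 -> onth (P1 ++ i :: P2) n =
  Some i.
Proof. by move=> ->; rewrite onth_cat ltnn subnn. Qed.

(** Induction on the derivation. The surrounding code is arbitrary because a subcommand always sits
    inside a longer program; jump targets are absolute, so only the size of [P1] matters. *)
Lemma exec_reach p c s s' : exec p c s s' -> forall P1 P2 a, a = size P1 ->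
  reach p (P1 ++ compile c a ++ P2) (a, s) (a + clen c, s').
Proof.
elim=> {c s s'} [s|r f h l|d f h l|v f h l|c1 c2 s s1 s2 _ IH1 _ IH2
  |r c s r0|r c f h l n s1 s2 rn _ IH1 _ IH2
  |r c1 c2 s s1 r0 _ IH|r c1 c2 f h l n s1 rn _ IH
  |c1 c2 s s1 u1 _ IH|c1 c2 s s1 u2 _ IH] P1 P2 a aE.
- by rewrite addn0; exact: reach_refl.
- by apply: reach1; rewrite /= ?onth_size ?addn1 //; exact: reach_refl.
- by apply: reach1; rewrite /= ?onth_size ?addn1 //; exact: reach_refl.
- by apply: reach1; rewrite /= ?onth_size ?addn1 //; exact: reach_refl.
- apply: (reach_trans (y := (a + clen c1, s1))).
    by rewrite /= -catA; exact: IH1.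
  rewrite /= addnA -!catA catA; apply: IH2.
  by rewrite size_cat size_compile -aE.
- by apply: reach1; rewrite /= ?onth_size // r0; exact: reach_refl.
- apply: (reach1 (y := (a.+1, CState (upd f r n) h l))).
    by rewrite /= onth_size //= rn.
  apply: (reach_trans (y := (a, s1))); last exact: IH2.
  apply: (reach_trans (y := (a.+1 + clen c, s1))).
    rewrite [compile _ _]/= [_ ++ P2]/= !cat_rcons -(cat_rcons _ P1).
    by apply: IH1; rewrite size_rcons aE.
  apply: reach1; last exact: reach_refl.
  rewrite [compile _ _]/= [_ ++ P2]/= !cat_rcons -(cat_rcons _ P1) catA /instr_step
    onth_size //.
  by rewrite size_cat size_rcons size_compile -aE; lia.
- apply: (reach1 (y := (a + (clen c1).+2, s))).
    by rewrite /= onth_size //= r0.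
  rewrite /= (_ : a + (clen c1 + clen c2).+2 = a + (clen c1).+2 + clen c2); last by lia.
  set J := IJump _; set D := IDec _ _.
  rewrite (_ : P1 ++ _ = (P1 ++ D :: rcons (compile c1 a.+1) J) ++
     compile c2 (a + (clen c1).+2) ++ P2); last by rewrite /= -?catA /=
       -?catA ?cat_rcons.
  by apply: IH; rewrite size_cat /= size_rcons size_compile aE.
- apply: (reach1 (y := (a.+1, CState (upd f r n) h l))).
    by rewrite /= onth_size //= rn.
  set J := IJump (a + (clen c1 + clen c2).+2).
  apply: (reach_trans (y := (a.+1 + clen c1, s1))).
    rewrite [compile _ _]/= [_ ++ P2]/= -(cat_rcons _ P1) -catA.
    by apply: IH; rewrite size_rcons aE.
  apply: reach1; last exact: reach_refl.
  rewrite [compile _ _]/= [_ ++ P2]/= -(cat_rcons _ P1) -catA catA /instr_step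
    onth_size //.
  by rewrite size_cat size_rcons size_compile aE; lia.
- apply: (reach1 (y := (a.+1, s))).
    by rewrite /= onth_size //= u1.
  set J := IJump (a + (clen c1 + clen c2).+2).
  apply: (reach_trans (y := (a.+1 + clen c1, s1))).
    rewrite [compile _ _]/= [_ ++ P2]/= -(cat_rcons _ P1) -catA.
    by apply: IH; rewrite size_rcons aE.
  apply: reach1; last exact: reach_refl.
  rewrite [compile _ _]/= [_ ++ P2]/= -(cat_rcons _ P1) -catA catA /instr_step
    onth_size //.
  by rewrite size_cat size_rcons size_compile aE; lia.
- apply: (reach1 (y := (a + (clen c1).+2, s))).
    by rewrite /= onth_size //= u2.
  rewrite /= (_ : a + (clen c1 + clen c2).+2 = a + (clen c1).+2 + clen c2); last by lia.
  set J := IJump _; set D := ITest _.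
  rewrite (_ : P1 ++ _ = (P1 ++ D :: rcons (compile c1 a.+1) J) ++
     compile c2 (a + (clen c1).+2) ++ P2); last by rewrite /= -?catA /=
       -?catA ?cat_rcons.
  by apply: IH; rewrite size_cat /= size_rcons size_compile aE.
Qed.

Fixpoint cregs (c : cmd) : nat :=
  match c with
  | CInc r => r.+1
  | CSeq c1 c2 | CTest c1 c2 => maxn (cregs c1) (cregs c2)
  | CLoop r c1 => maxn r.+1 (cregs c1)
  | CIf r c1 c2 => maxn r.+1 (maxn (cregs c1) (cregs c2))
  | _ => 0
  end.

Fixpoint couts (b : bool) (c : cmd) : bool :=
  match c with
  | COut v => b || (v < 3)
  | CSeq c1 c2 | CTest c1 c2 | CIf _ c1 c2 => couts b c1 && couts b c2
  | CLoop _ c1 => couts b c1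
  | _ => true
  end.

Lemma compile_wf b k S c a : cregs c <= k -> couts b c -> a + clen c <= S ->
  all (wf_instr b k S) (compile c a).
Proof.
elim: c a => //= [r|v|c1 IH1 c2 IH2|r c IH|r c1 IH1 c2 IH2|c1 IH1 c2 IH2] a.
- by move=> -> _ _.
- by move=> _ -> _.
- by move=> ck /andP[o1 o2] aS; rewrite all_cat IH1 ?IH2 //; lia.
- move=> ck o aS; rewrite all_rcons IH //=; lia.
- move=> ck /andP[o1 o2] aS; rewrite all_cat /= IH1 ?IH2 //; lia.
- move=> ck /andP[o1 o2] aS; rewrite all_cat /= IH1 ?IH2 //; lia.
Qed.

Ltac upd_tac := rewrite /= /upd /=;
  repeat (case: eqP => [?|?]; subst => //=); try lia; try congruence.

Lemma exec_loop p c r (s : nat -> cstate) n :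
  (forall i, i < n -> regs (s i) r = n - i /\
     exec p c (CState (upd (regs (s i)) r (n - i.+1)) (ihead (s i)) (olog (s i))) (s
       i.+1)) ->
  regs (s n) r = 0 -> exec p (CLoop r c) (s 0) (s n).
Proof.
elim: n s => [|n IH] s H sn; first exact: ELoop0.
have [r0 e0] := H 0 isT.
case: (s 0) r0 e0 => f h l /= r0 e0.
rewrite subSS subn0 in e0; apply: (ELoopS r0 e0).
apply: (IH (fun i => s i.+1)) => // i ni.
by have := H i.+1 ni; rewrite !subSS.
Qed.

Lemma exec_move p r r' f h l : r != r' ->
  exec p (CLoop r (CInc r')) (CState f h l) (CState (upd (upd f r' (f r' + f r)) r 0)
    h l).
Proof.
move=> rr'; pose s i := CState (upd (upd f r' (f r' + i)) r (f r - i)) h l.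
have -> : CState f h l = s 0.
  by congr CState; apply/funext => x; upd_tac.
have -> : CState (upd (upd f r' (f r' + f r)) r 0) h l = s (f r) by rewrite /s subnn.
apply: exec_loop => [i fi|]; last by rewrite /= /upd eqxx subnn.
rewrite /s /=; split; first by rewrite /upd eqxx.
have -> : upd (upd f r' (f r' + i.+1)) r (f r - i.+1) =
   upd (upd (upd (upd f r' (f r' + i)) r (f r - i)) r (f r - i.+1)) r'
     ((upd (upd (upd f r' (f r' + i)) r (f r - i)) r (f r - i.+1)) r').+1.
  by apply/funext => x; upd_tac.
exact: EInc.
Qed.

Lemma exec_eq p c s f f' h l : exec p c s (CState f h l) -> f =1 f' ->
  exec p c s (CState f' h l).
Proof. by move=> + /funext <-. Qed.

Lemma exec_clear p r f h l : exec p (CLoop r CSkip) (CState f h l) (CState (upd f r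
  0) h l).
Proof.
pose s i := CState (upd f r (f r - i)) h l.
have -> : CState f h l = s 0 by congr CState; apply/funext => x; upd_tac.
have -> : CState (upd f r 0) h l = s (f r) by rewrite /s subnn.
apply: exec_loop => [i fi|]; last by rewrite /= /upd eqxx subnn.
rewrite /s /=; split; first by rewrite /upd eqxx.
have -> : upd (upd f r (f r - i)) r (f r - i.+1) = upd f r (f r - i.+1).
  by apply/funext => x; upd_tac.
exact: ESkip.
Qed.

(** Reading a register empties it; hence [r] is moved into both [d] and the scratch register [t],
    and then restored from [t]. *)
Definition copy (r t d : nat) : cmd :=
  CSeq (CLoop r (CSeq (CInc t) (CInc d))) (CLoop t (CInc r)).

Lemma exec_copy p r t d f h l : r < d -> d < t -> f t = 0 -> f d = 0 ->
  exec p (copy r t d) (CState f h l) (CState (upd f d (f r)) h l).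
Proof.
move=> rd dt ft fd.
pose s i := CState (upd (upd (upd f t i) d i) r (f r - i)) h l.
apply: (ESeq (s1 := s (f r))).
  have -> : CState f h l = s 0 by congr CState; apply/funext => x; upd_tac.
  apply: exec_loop => [i fi|]; last by rewrite /= /upd eqxx subnn.
  rewrite /s /=; split; first by rewrite /upd eqxx.
  apply: ESeq; first exact: EInc.
  apply: exec_eq; first exact: EInc.
  by move=> x; upd_tac.
apply: exec_eq; first by apply: exec_move; lia.
by move=> x; upd_tac.
Qed.

(** * Primitive recursion relative to the input tape *)

(* [Rec n e0 e1] binds in [e1] the recursive value as variable 0 and the counter
   as variable 1. *)
Inductive expr :=
  | Var of nat | Zero | Succ of expr | Cell of expr
  | Rec of expr & expr & expr.

Definition scons (a : nat) (s : nat -> nat) : nat -> nat :=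
  fun i => if i is j.+1 then s j else a.

Fixpoint prec (a : nat) (g : nat -> nat -> nat) (n : nat) : nat :=
  if n is m.+1 then g m (prec a g m) else a.

Fixpoint eval (p : baire) (s : nat -> nat) (e : expr) : nat :=
  match e with
  | Var i => s i
  | Zero => 0
  | Succ e => (eval p s e).+1
  | Cell e => unary p (eval p s e)
  | Rec n e0 e1 => prec (eval p s e0)
      (fun m ih => eval p (scons ih (scons m s)) e1) (eval p s n)
  end.

(* Variable [i] is held in register [rho i] and the value is left in register [d];
   the registers from [d] on are scratch space that is zero before, and above [d]
   zero afterwards.  The input head is at cell 0 between the reads. *)
Fixpoint cexpr (e : expr) (rho : nat -> nat) (d : nat) : cmd :=
  match e with
  | Var i => copy (rho i) d.+1 d
  | Zero => CSkip
  | Succ e => CSeq (cexpr e rho d) (CInc d)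
  | Cell e => CSeq (cexpr e rho d)
     (CSeq (CLoop d (CSeq (CIn Right) (CInc d.+1)))
     (CSeq (CTest (CInc d) (CSeq (CInc d) (CInc d)))
           (CLoop d.+1 (CIn Left))))
  | Rec n e0 e1 => CSeq (cexpr n rho d)
     (CSeq (cexpr e0 rho d.+2)
     (CSeq (CLoop d
        (CSeq (cexpr e1 (scons d.+2 (scons d.+1 rho)) d.+3)
        (CSeq (CLoop d.+2 CSkip)
        (CSeq (CLoop d.+3 (CInc d.+2)) (CInc d.+1)))))
     (CSeq (CLoop d.+1 CSkip) (CLoop d.+2 (CInc d)))))
  end.

Lemma couts_cexpr b e rho d : couts b (cexpr e rho d).
Proof.
elim: e rho d => //= [e IH|e IH|n IHn e0 IH0 e1 IH1] rho d;
  rewrite ?IH ?IHn ?IH0 ?IH1 //.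
Qed.

Lemma exec_cexpr p e rho d f l : (forall i, rho i < d) ->
  (forall r, d <= r -> f r = 0) ->
  exec p (cexpr e rho d) (CState f 0 l)
    (CState (upd f d (eval p (fun i => f (rho i)) e)) 0 l).
Proof.
elim: e rho d f => [i||e IH|e IH|n IHn e0 IH0 e1 IH1] rho d f rhoP f0 /=.
- by apply: exec_copy => //; apply: f0.
- have -> : upd f d 0 = f by apply/funext => x; rewrite /upd; case: eqP => // ->;
  rewrite f0.
  exact: ESkip.
- apply: ESeq; first exact: IH.
  apply: exec_eq; first exact: EInc.
  by move=> x; upd_tac.
- set v := eval p _ e.
  have fd : f d = 0 by apply: f0.
  have fd1 : f d.+1 = 0 by apply: f0.
  apply: ESeq; first exact: IH.
  (* State after [i] moves to the right: [d] counts the moves that remain, and [d.+1] remembers the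
     way back to cell 0. *)
  rewrite -/v; pose s i := CState (upd (upd f d (v - i)) d.+1 i) i l.
  apply: (ESeq (s1 := s v)).
    have -> : CState (upd f d v) 0 l = s 0 by congr CState; apply/funext => x; upd_tac.
    apply: exec_loop => [i iv|]; last by rewrite /=; upd_tac.
    rewrite /s /=; split; first by upd_tac.
    apply: ESeq; first exact: EIn.
    apply: exec_eq; first exact: EInc.
    by move=> x; upd_tac.
  rewrite /s subnn; set u := unary p v.
  apply: (ESeq (s1 := CState (upd (upd f d u) d.+1 v) v l)).
    case: (unary12 p v) => uE; [apply: ETest1 => // | apply: ETest2 => //];
      rewrite /u uE.
      apply: exec_eq; first exact: EInc.
      by move=> x; upd_tac.
    apply: ESeq; first exact: EInc.
    apply: exec_eq; first exact: EInc.
    by move=> x; upd_tac.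
  pose s' i := CState (upd (upd f d u) d.+1 (v - i)) (v - i) l.
  have -> : CState (upd (upd f d u) d.+1 v) v l = s' 0 by rewrite /s' subn0.
  have -> : CState (upd f d u) 0 l = s' v.
    by rewrite /s' subnn; congr CState; apply/funext => x; upd_tac.
  apply: exec_loop => [i iv|]; last by rewrite /=; upd_tac.
  rewrite /s' /=; split; first by upd_tac.
  rewrite (_ : v - i.+1 = move_head Left (v - i)) /=; last by lia.
  apply: exec_eq; first exact: EIn.
  by move=> x; upd_tac.
- set N := eval p _ n; set a := eval p _ e0.
  set g := fun m ih : nat => _.
  have fd i : f (d + i) = 0 by apply: f0; lia.
  have fd0 : f d = 0 by rewrite -(fd 0) addn0.
  have fd1 : f d.+1 = 0 by rewrite -(fd 1) addn1.
  have fd2 : f d.+2 = 0 by rewrite -(fd 2) addn2.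
  have fd3 : f d.+3 = 0 by rewrite -(fd 3) addn3.
  apply: ESeq; first exact: IHn.
  (* Loop invariant: [d] holds the remaining rounds, [d.+1] the counter and [d.+2] the recursive
     value. *)
  rewrite -/N; pose s i := CState (upd (upd (upd f d (N - i)) d.+1 i) d.+2 (prec a g
    i)) 0 l.
  apply: (ESeq (s1 := s 0)).
    apply: exec_eq; first apply: IH0.
    - by move=> i; have := rhoP i; lia.
    - by move=> r dr; rewrite /upd; case: eqP => [|_]; [lia | apply: f0; lia].
    move=> x; rewrite (_ : (fun i => upd f d N (rho i)) = (fun i => f (rho i))).
      by rewrite -/a; upd_tac.
    by apply/funext => i; rewrite /upd ltn_eqF.
  apply: (ESeq (s1 := s N)); last first.
    apply: ESeq; first exact: exec_clear.
    apply: exec_eq; first by apply: exec_move; lia.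
    by move=> x; rewrite subnn; upd_tac.
  apply: exec_loop => [i iN|]; last by rewrite /=; upd_tac.
  rewrite /s /=; split; first by upd_tac.
  set f1 := upd _ d (N - i.+1).
  have f1E j : f1 (scons d.+2 (scons d.+1 rho) j) =
      scons (prec a g i) (scons i (fun j => f (rho j))) j.
    case: j => [|[|j]] /=; rewrite /f1; [by upd_tac| by upd_tac|].
    by have := rhoP j; upd_tac.
  apply: ESeq.
    apply: IH1.
    - by case=> [|[|j]] //=; have := rhoP j; lia.
    - by move=> r dr; rewrite /f1 /upd; do !(case: eqP => [|_]; first by lia);
      apply: f0; lia.
  rewrite (funext f1E) -/(g i (prec a g i)).
  apply: ESeq; first exact: exec_clear.
  apply: ESeq; first by apply: exec_move; lia.
  apply: exec_eq; first exact: EInc.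
  by move=> x; rewrite /f1; upd_tac.
Qed.

(** * The main loop and its machine *)

Lemma reach_loop p P1 P2 a r c f h l n s1 : a = size P1 -> f r = n.+1 ->
  exec p c (CState (upd f r n) h l) s1 ->
  reach p (P1 ++ compile (CLoop r c) a ++ P2) (a, CState f h l) (a, s1).
Proof.
move=> aE rn /exec_reach H.
apply: (reach1 (y := (a.+1, CState (upd f r n) h l))).
  by rewrite /= onth_size //= rn.
apply: (reach_trans (y := (a.+1 + clen c, s1))).
  rewrite [compile _ _]/= [_ ++ P2]/= !cat_rcons -(cat_rcons _ P1).
  by apply: H; rewrite size_rcons aE.
apply: reach1; last exact: reach_refl.
rewrite [compile _ _]/= [_ ++ P2]/= !cat_rcons -(cat_rcons _ P1) catA /instr_step
  onth_size //.
by rewrite size_cat size_rcons size_compile -aE; lia.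
Qed.

(* Register 0 holds the parameter, 1 the stage, 3 the flag that keeps the loop
   running and 4 the value of the expression; register 2 stays 0 and serves as
   the value of all other variables. *)
Definition out_cmd (v : nat) : cmd := CSeq (COut v) (CInc 3).

(** The nested tests distinguish the values of the expression. An action is emitted and raises the
    flag again; any other value leaves the flag at 0 and thereby ends the program. *)
Definition body_cmd (b : bool) (e : expr) : cmd :=
  CSeq (cexpr e (minn 2) 4) (CSeq (CInc 1)
    (CIf 4 (CIf 4 (CIf 4 (CIf 4 CSkip (if b then out_cmd 3 else CSkip))
       (out_cmd 2)) (out_cmd 1)) (out_cmd 0))).

Definition main_cmd (b : bool) (e : expr) : cmd :=
  CSeq (CInc 3) (CLoop 3 (body_cmd b e)).

Definition loop_st (m n : nat) (l : seq nat) : cstate :=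
  CState (upd (upd (upd (fun=> 0) 0 m) 1 n) 3 1) 0 l.

Lemma couts_main b e : couts b (main_cmd b e).
Proof. by rewrite /= couts_cexpr; case: b. Qed.

Lemma exec_body p b e m n l v :
  v = eval p (scons m (scons n (fun=> 0))) e ->
  exists2 s', exec p (body_cmd b e) (CState (upd (regs (loop_st m n l)) 3 0) 0 l) s' &
    if v < 3 + b then s' = loop_st m n.+1 (rcons l v) else regs s' 3 = 0.
Proof.
move=> vE; set f := upd _ 3 0.
pose f1 u := upd (upd (upd (fun=> 0) 0 m) 1 n.+1) 4 u.
have H s' : exec p (CIf 4 (CIf 4 (CIf 4 (CIf 4 CSkip (if b then out_cmd 3 else CSkip))
    (out_cmd 2)) (out_cmd 1)) (out_cmd 0)) (CState (f1 v) 0 l) s' ->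
    exec p (body_cmd b e) (CState f 0 l) s'.
  move=> Hs; apply: ESeq.
    apply: exec_cexpr; first by move=> i; lia.
    by move=> r r4; rewrite /f /=; upd_tac.
  apply: ESeq Hs.
  apply: exec_eq; first exact: EInc.
  have -> : (fun i => f (minn 2 i)) = scons m (scons n (fun=> 0)).
    by apply/funext => -[|[|[|i]]].
  by rewrite -vE => x; rewrite /f /f1; upd_tac.
have out s w u : s = f1 0 -> exec p (out_cmd w) (CState s 0 l) (loop_st m n.+1 (rcons
  l w)).
  move=> ->; apply: ESeq; first exact: EOut.
  by apply: exec_eq; [exact: EInc | move=> x; rewrite /f1; upd_tac].
have f1S w : upd (f1 w.+1) 4 w = f1 w by apply/funext => x; rewrite /f1; upd_tac.
case: v vE H => [|[|[|[|v]]]] vE H.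
- exists (loop_st m n.+1 (rcons l 0)); last by case: (b).
  by apply: H; apply: EIf0 => //; apply: out.
- exists (loop_st m n.+1 (rcons l 1)); last by case: (b).
  apply: H; apply: EIfS; [by []|]; rewrite f1S.
  by apply: EIf0 => //; apply: out.
- exists (loop_st m n.+1 (rcons l 2)); last by case: (b).
  apply: H; apply: EIfS; [by []|]; rewrite f1S.
  apply: EIfS; [by []|]; rewrite f1S.
  by apply: EIf0 => //; apply: out.
- case: (b) H => H.
    exists (loop_st m n.+1 (rcons l 3)) => //.
    apply: H; do 3!(apply: EIfS; [by []|]; rewrite f1S).
    by apply: EIf0 => //; apply: out.
  exists (CState (f1 0) 0 l) => //.
  apply: H; do 3!(apply: EIfS; [by []|]; rewrite f1S).
  by apply: EIf0 => //; exact: ESkip.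
- exists (CState (f1 v) 0 l); last by case: (b).
  apply: H; do 4!(apply: EIfS; [by []|]; rewrite f1S).
  exact: ESkip.
Qed.

Lemma encode_out k p q s (c : config k) : c = encode k p q s ->
  (Defs.head c ord_max, tape c ord_max) = emits (olog s).
Proof. by move=> ->; rewrite /= /head_at /tape_at /= eqxx; case: (emits _). Qed.

Lemma one_way_rule k q q' rd tr :
  (if (tr k.+1).2 is Left then false else true) ->
  if (tnth (decode_rule k (mkrule k q q' rd tr)).2.2 ord_max).2 is Left
  then false else true.
Proof. by rewrite decode_mkrule tnth_mktuple. Qed.

Lemma one_way_trans k S ins pc rd : wf_instr false k S ins ->
  if ((trans k ins pc rd).2 k.+1).2 is Left then false else true.
Proof.
case: ins => [r|r l|l|d|l|[|[|[|v]]]] //=; try by rewrite eqxx.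
  by move=> rk; rewrite eqSS gtn_eqF.
by case/andP=> rk _; case: ifP => //= _; rewrite eqSS gtn_eqF.
Qed.

Section MainProgram.
Variables (b : bool) (e : expr) (phi : baire -> nat -> nat -> nat).
Hypothesis eE : forall p s, eval p s e = phi p (s 0) (s 1).

Let P := compile (main_cmd b e) 0.

Lemma reach_main p m n : (forall i, i < n -> phi p m i < 3 + b) ->
  reach p P (0, param_st m) (1, loop_st m n (mkseq (phi p m) n)).
Proof.
elim: n => [_|n IH ok].
  apply: (reach1 (y := (1, loop_st m 0 [::]))); last exact: reach_refl.
  congr (Some (_, CState _ _ _)); apply/funext => x; upd_tac.
apply: reach_trans; first by apply: IH => i /ltnW; apply: ok.
have [s' Hs] := @exec_body p b e m n (mkseq (phi p m) n) (phi p m n) (esym (eE _ _)).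
rewrite ok // -mkseqS => s'E; rewrite -s'E.
rewrite /P [compile _ _]/= -[_ :: rcons _ _]/(compile (CLoop 3 (body_cmd b e)) 1).
rewrite -cat1s -[compile (CLoop _ _) _]cats0.
exact: reach_loop Hs.
Qed.

Lemma reach_stop p m n : (forall i, i < n -> phi p m i < 3 + b) ->
  3 + b <= phi p m n -> exists2 x, reach p P (0, param_st m) x & instr_step p P x =
    None.
Proof.
move=> ok stop.
have [s' Hs] := @exec_body p b e m n (mkseq (phi p m) n) (phi p m n) (esym (eE _ _)).
rewrite ltnNge stop /= => s'0.
exists (1 + clen (CLoop 3 (body_cmd b e)), s').
  apply: reach_trans (reach_main ok) _.
  rewrite /P [compile _ _]/= -[_ :: rcons _ _]/(compile (CLoop 3 (body_cmd b e)) 1).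
  rewrite -cat1s -[compile (CLoop _ _) _]cats0.
  apply: reach_trans; first exact: reach_loop Hs.
  apply: exec_reach => //; exact: ELoop0.
by rewrite /instr_step onth_default // size_compile.
Qed.

(** At most one action per step: this turns a count of actions into a lower bound on time, both for
    the output and for halting. *)
Lemma instr_next_log p x : exists2 w, olog (instr_next p P x).2 =
  olog x.2 ++ w & size w <= 1.
Proof.
case: x => pc s; rewrite /instr_next /instr_step.
case: (onth P pc) => [[r|r l|l|d|l|v]|] /=; try by exists [::]; rewrite ?cats0.
  by case: (regs s r) => [|n] /=; exists [::]; rewrite ?cats0.
by exists [:: v]; rewrite ?cats1.
Qed.

Lemma iter_log p x t u : exists w, olog (iter (u + t) (instr_next p P) x).2 =
  olog (iter t (instr_next p P) x).2 ++ w.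
Proof.
elim: u => [|u [w IH]]; first by exists [::]; rewrite cats0.
rewrite addSn iterS; have [w' -> _] := instr_next_log p (iter (u + t) (instr_next p
  P) x).
by exists (w ++ w'); rewrite IH catA.
Qed.

Lemma iter_log_size p m t : size (olog (iter t (instr_next p P) (0, param_st m)).2)
  <= t.
Proof.
elim: t => // t IH; rewrite iterS.
have [w -> w1] := instr_next_log p (iter t (instr_next p P) (0, param_st m)).
by rewrite size_cat; lia.
Qed.

Variable k : nat.
Hypotheses (k0 : 0 < k) (kP : cregs (main_cmd b e) <= k).

Let wf : all (wf_instr b k (size P)) P.
Proof. by apply: compile_wf; rewrite ?couts_main ?size_compile. Qed.

Lemma main_out p m : (forall n, phi p m n < 3 + b) -> exists nu : nat -> nat,
  (forall t, (out_head (param_machine k P m) p t, out (param_machine k P m) p t) =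
     emits (mkseq (phi p m) (nu t))) /\
  (forall N, exists T, forall t, T <= t -> N <= nu t).
Proof.
move=> ok; have [out0 runE] := run_param m p k0 wf.
pose lg t := olog (iter t (instr_next p P) (0, param_st m)).2.
(* Truncated subtraction makes this 0 during the set-up, when the output tape is still blank. *)
exists (fun t => size (lg (t - m.+1))).
have reached n : exists t, lg t = mkseq (phi p m) n.
  have [t tE] := @reach_main p m n (fun i _ => ok i).
  by exists t; rewrite /lg tE.
have lgE t : lg t = mkseq (phi p m) (size (lg t)).
  (* [T] is a time at which exactly [t] actions have been emitted. Then [t <= T], so the log at time
     [t] is a prefix of a log that is known. *)
  have [T TE] := reached t.
  have tT : t <= T by have := iter_log_size p m T; rewrite -/(lg T) TE size_mkseq.
  have [w] := iter_log p (0, param_st m) t (T - t).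
  rewrite subnK // -/(lg T) -/(lg t) TE => E.
  apply: (@eq_from_nth _ 0); first by rewrite size_mkseq.
  move=> i isz; rewrite nth_mkseq //.
  have := congr1 (fun l => nth 0 l i) E; rewrite nth_cat isz nth_mkseq //.
  have := congr1 size E; rewrite size_mkseq size_cat; lia.
have outE u : (out_head (param_machine k P m) p (m.+1 + u),
    out (param_machine k P m) p (m.+1 + u)) = emits (lg u).
  exact: encode_out (runE u).
split=> [t|N].
  have [tm|mt] := leqP t m.+1.
    have [-> out1] := out0 _ tm; rewrite (_ : t - m.+1 = 0); last by lia.
    by rewrite /= /emits /=; congr pair; apply/funext.
  by rewrite -lgE -outE subnKC // ltnW.
have [T TE] := reached N; exists (m.+1 + T) => t mt.
have [w E] := iter_log p (0, param_st m) T (t - m.+1 - T).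
move: E; rewrite subnK; last by lia.
by rewrite -/(lg T) -/(lg (t - m.+1)) TE => ->; rewrite size_cat size_mkseq leq_addr.
Qed.

Lemma instr_step_main_bound p m t :
  (iter t (instr_next p P) (0, param_st m)).1 <= size P.
Proof.
elim: t => // t IH; rewrite iterS /instr_next.
by case E: (instr_step p P _) => [y|] //=; apply: (instr_step_bound wf erefl E).
Qed.

Lemma stop_run (M : machine) p t u : step (run M p t) = None ->
  run M p (u + t) = run M p t.
Proof. by move=> stop; elim: u => // u IH; rewrite addSn runS IH stop. Qed.

Lemma main_halts p m :
  halts (param_machine k P m) p <-> exists n, 3 + b <= phi p m n.
Proof.
have [_ runE] := run_param m p k0 wf.
have stepE t : step (run (param_machine k P m) p (m.+1 + t)) =
    omap (encode_pc k p P) (instr_step p P (iter t (instr_next p P) (0, param_st m))).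
  by rewrite runE (step_encode _ _ wf) // instr_step_main_bound.
split=> [[t stop]|ex]; last first.
  have := ex_minnP ex; case=> n stop least.
  have ok i : i < n -> phi p m i < 3 + b.
    by move=> lt_in; rewrite ltnNge; apply/negP => /least; rewrite leqNgt lt_in.
  have [x [t tE] xN] := reach_stop ok stop.
  by exists (m.+1 + t); rewrite stepE tE xN.
apply: contrapT => none.
have ok i : phi p m i < 3 + b.
  by rewrite ltnNge; apply/negP => ?; apply: none; exists i.
have stop' : instr_step p P (iter t (instr_next p P) (0, param_st m)) = None.
  have := stepE t; rewrite stop_run // stop; by case: (instr_step _ _ _).
have const u : iter (u + t) (instr_next p P) (0, param_st m) =
  iter t (instr_next p P) (0, param_st m).
  by elim: u => // u IH; rewrite addSn iterS IH /instr_next stop'.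
(* The stopped run has emitted at most [t] actions, but without a stopping value [t.+1] actions are
   emitted eventually. *)
have [T TE] := @reach_main p m t.+1 (fun i _ => ok i).
have sT := iter_log_size p m t.
have := iter_log_size p m T; rewrite TE size_mkseq => tT.
move: sT; rewrite -(const (T - t)) subnK ?(ltnW tT) // TE size_mkseq.
by rewrite ltnn.
Qed.

Lemma main_one_way m : b = false -> one_way (param_machine k P m).
Proof.
move=> b0; rewrite /one_way [table _](_ : _ = map (decode_rule k)
  (init_rules k (size P) m ++ chain k P m)) // all_map all_cat; apply/andP; split.
  by apply/allP => l; rewrite !inE => /orP[] /eqP ->; apply: one_way_rule.
elim: m => [|m IH].
  rewrite all_map; apply/allP => -[pc t] /allpairsP[[pc' t'] [+ _ [-> ->]]].
  rewrite mem_iota add0n => pcS; apply: one_way_rule.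
  apply: (@one_way_trans _ (size P)).
  by rewrite -b0; apply: (all_nthP _ wf).
rewrite chainS all_cat IH andbT all_map; apply/allP => x _.
by apply: one_way_rule; rewrite /= eqSS gtn_eqF.
Qed.

End MainProgram.

(** * Closure properties of primitive recursive functions *)

Definition primrec (f : baire -> (nat -> nat) -> nat) : Prop :=
  exists e, forall p s, eval p s e = f p s.

Definition upr (xi : nat -> nat) : nat -> nat :=
  fun i => if i is j.+1 then (xi j).+1 else 0.

Fixpoint ren (xi : nat -> nat) (e : expr) : expr :=
  match e with
  | Var i => Var (xi i)
  | Zero => Zero
  | Succ e => Succ (ren xi e)
  | Cell e => Cell (ren xi e)
  | Rec n e0 e1 => Rec (ren xi n) (ren xi e0) (ren (upr (upr xi)) e1)
  end.

Lemma eval_ren p s xi e : eval p s (ren xi e) = eval p (fun i => s (xi i)) e.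
Proof.
elim: e s xi => //= [e IH|e IH|n IHn e0 IH0 e1 IH1] s xi; rewrite ?IH //.
rewrite IHn IH0; congr prec; apply/funext => m; apply/funext => ih.
by rewrite IH1; congr eval; apply/funext => -[|[|i]].
Qed.

Definition ups (sg : nat -> expr) : nat -> expr :=
  fun i => if i is j.+1 then ren succn (sg j) else Var 0.

Fixpoint subst (sg : nat -> expr) (e : expr) : expr :=
  match e with
  | Var i => sg i
  | Zero => Zero
  | Succ e => Succ (subst sg e)
  | Cell e => Cell (subst sg e)
  | Rec n e0 e1 => Rec (subst sg n) (subst sg e0) (subst (ups (ups sg)) e1)
  end.

Lemma eval_subst p s sg e : eval p s (subst sg e) = eval p (fun i => eval p s (sg i)) e.
Proof.
elim: e s sg => //= [e IH|e IH|n IHn e0 IH0 e1 IH1] s sg; rewrite ?IH //.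
rewrite IHn IH0; congr prec; apply/funext => m; apply/funext => ih.
by rewrite IH1; congr eval; apply/funext => -[|[|i]] //=; rewrite !eval_ren.
Qed.

Lemma pr_ext f g : (forall p s, f p s = g p s) -> primrec f -> primrec g.
Proof. by move=> fg [e eE]; exists e => p s; rewrite eE fg. Qed.

Lemma pr_var i : primrec (fun p s => s i). Proof. by exists (Var i). Qed.

Lemma pr_succ f : primrec f -> primrec (fun p s => (f p s).+1).
Proof. by move=> [e eE]; exists (Succ e) => p s /=; rewrite eE. Qed.

Lemma pr_const c : primrec (fun p s => c).
Proof. by elim: c => [|c /pr_succ//]; exists Zero. Qed.

Lemma pr_cell f : primrec f -> primrec (fun p s => unary p (f p s)).
Proof. by move=> [e eE]; exists (Cell e) => p s /=; rewrite eE. Qed.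

Lemma pr_prec a g n : primrec a -> primrec n ->
  primrec (fun p s => g p (s 1) (s 0) (fun i => s i.+2)) ->
  primrec (fun p s => prec (a p s) (fun m ih => g p m ih s) (n p s)).
Proof.
move=> [ea aE] [en nE] [eg gE]; exists (Rec en ea eg) => p s /=.
by rewrite aE nE; congr prec; apply/funext => m; apply/funext => ih; rewrite gE.
Qed.

(** Composition in all variables at once; the expressions for the infinitely many [sg i] are picked
    by choice. *)
Lemma pr_subst f (sg : nat -> baire -> (nat -> nat) -> nat) :
  primrec f -> (forall i, primrec (sg i)) ->
  primrec (fun p s => f p (fun i => sg i p s)).
Proof.
move=> [e eE] /choice[sg' sgE]; exists (subst sg' e) => p s.
by rewrite eval_subst eE; congr f; apply/funext => i; rewrite sgE.
Qed.

Lemma pr_comp1 h f : primrec (fun p s => h p (s 0)) -> primrec f ->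
  primrec (fun p s => h p (f p s)).
Proof. by move=> hP fP; apply: (pr_subst hP (sg := fun _ => f)). Qed.

Lemma pr_comp2 h f g : primrec (fun p s => h p (s 0) (s 1)) ->
  primrec f -> primrec g -> primrec (fun p s => h p (f p s) (g p s)).
Proof.
move=> hP fP gP.
by apply: (pr_subst hP (sg := fun i => if i is 0 then f else g)) => -[].
Qed.

Lemma pr_comp3 h f g k : primrec (fun p s => h p (s 0) (s 1) (s 2)) ->
  primrec f -> primrec g -> primrec k ->
  primrec (fun p s => h p (f p s) (g p s) (k p s)).
Proof.
move=> hP fP gP kP.
by apply: (pr_subst hP (sg := fun i => match i with 0 => f | 1 => g | _ => k end)) =>
  -[|[]].
Qed.

Lemma pr_comp4 h f g k l : primrec (fun p s => h p (s 0) (s 1) (s 2) (s 3)) ->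
  primrec f -> primrec g -> primrec k -> primrec l ->
  primrec (fun p s => h p (f p s) (g p s) (k p s) (l p s)).
Proof.
move=> hP fP gP kP lP.
by apply: (pr_subst hP (sg := fun i =>
  match i with 0 => f | 1 => g | 2 => k | _ => l end)) => -[|[|[]]].
Qed.

Lemma pr_let g f : primrec (fun p s => g p (s 0) (fun i => s i.+1)) -> primrec f ->
  primrec (fun p s => g p (f p s) s).
Proof.
move=> gP fP; apply: (pr_subst gP (sg := fun i => if i is j.+1 then fun _ s =>
  s j else f)).
by case=> // i; exact: pr_var.
Qed.

Lemma pr_shift xi f : primrec f -> primrec (fun p s => f p (fun i => s (xi i))).
Proof. by move=> fP; apply: (pr_subst fP (sg := fun i _ s => s (xi i))) => i;
  exact: pr_var. Qed.

Create HintDb pr discriminated.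
#[local] Hint Constants Opaque : pr.
#[local] Hint Resolve pr_var pr_succ pr_cell : pr.
#[local] Hint Resolve pr_const | 10 : pr.

Ltac pr := cbv beta; auto 100 with pr.

Lemma pr_add f g : primrec f -> primrec g -> primrec (fun p s => f p s + g p s).
Proof.
apply: (pr_comp2 (h := fun _ x y => x + y)).
apply: (pr_ext (f := fun p s => prec (s 0) (fun _ ih => ih.+1) (s 1))).
  by move=> p s; elim: (s 1) => [|n IH] /=; rewrite ?addn0 // IH addnS.
apply: (@pr_prec _ (fun _ _ ih _ => ih.+1)); pr.
Qed.
#[local] Hint Resolve pr_add : pr.

Lemma pr_pred f : primrec f -> primrec (fun p s => (f p s).-1).
Proof.
apply: (pr_comp1 (h := fun _ x => x.-1)).
apply: (pr_ext (f := fun p s => prec 0 (fun m _ => m) (s 0))).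
  by move=> p s; case: (s 0).
apply: (@pr_prec _ (fun _ m _ _ => m)); pr.
Qed.
#[local] Hint Resolve pr_pred : pr.

Lemma pr_sub f g : primrec f -> primrec g -> primrec (fun p s => f p s - g p s).
Proof.
apply: (pr_comp2 (h := fun _ x y => x - y)).
apply: (pr_ext (f := fun p s => prec (s 0) (fun _ ih => ih.-1) (s 1))).
  by move=> p s; elim: (s 1) => [|n IH] /=; rewrite ?subn0 // IH subnS.
apply: (@pr_prec _ (fun _ _ ih _ => ih.-1)); pr.
Qed.
#[local] Hint Resolve pr_sub : pr.

Lemma pr_mul f g : primrec f -> primrec g -> primrec (fun p s => f p s * g p s).
Proof.
apply: (pr_comp2 (h := fun _ x y => x * y)).
apply: (pr_ext (f := fun p s => prec 0 (fun _ ih => ih + s 0) (s 1))).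
  by move=> p s; elim: (s 1) => [|n IH] /=; rewrite ?muln0 // IH mulnS addnC.
apply: (@pr_prec _ (fun _ _ ih s => ih + s 0)); pr.
Qed.
#[local] Hint Resolve pr_mul : pr.

Lemma pr_exp f g : primrec f -> primrec g -> primrec (fun p s => f p s ^ g p s).
Proof.
apply: (pr_comp2 (h := fun _ x y => x ^ y)).
apply: (pr_ext (f := fun p s => prec 1 (fun _ ih => ih * s 0) (s 1))).
  by move=> p s; elim: (s 1) => [|n IH] //=; rewrite IH expnSr.
apply: (@pr_prec _ (fun _ _ ih s => ih * s 0)); pr.
Qed.
#[local] Hint Resolve pr_exp : pr.

Lemma pr_if (c : baire -> (nat -> nat) -> bool) f g :
  primrec (fun p s => nat_of_bool (c p s)) -> primrec f -> primrec g ->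
  primrec (fun p s => if c p s then f p s else g p s).
Proof.
move=> cP fP gP.
apply: (pr_ext (f := fun p s => nat_of_bool (c p s) * f p s + (1 - nat_of_bool (c p
  s)) * g p s)).
  by move=> p s; case: (c p s); rewrite /= ?mul1n ?mul0n ?addn0.
pr.
Qed.
#[local] Hint Resolve pr_if : pr.

Lemma pr_leq f g : primrec f -> primrec g ->
  primrec (fun p s => nat_of_bool (f p s <= g p s)).
Proof.
move=> fP gP; apply: (pr_ext (f := fun p s => 1 - (f p s - g p s))).
  by move=> p s; case: (leqP (f p s)) => h; lia.
pr.
Qed.
#[local] Hint Resolve pr_leq : pr.

Lemma pr_not (c : baire -> (nat -> nat) -> bool) :
  primrec (fun p s => nat_of_bool (c p s)) ->
  primrec (fun p s => nat_of_bool (~~ c p s)).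
Proof.
move=> cP; apply: (pr_ext (f := fun p s => 1 - nat_of_bool (c p s))).
  by move=> p s; case: (c p s).
pr.
Qed.
#[local] Hint Resolve pr_not : pr.

Lemma pr_and (c d : baire -> (nat -> nat) -> bool) :
  primrec (fun p s => nat_of_bool (c p s)) ->
  primrec (fun p s => nat_of_bool (d p s)) ->
  primrec (fun p s => nat_of_bool (c p s && d p s)).
Proof.
move=> cP dP; apply: (pr_ext (f := fun p s => nat_of_bool (c p s) * nat_of_bool (d p
  s))).
  by move=> p s; case: (c p s); case: (d p s).
pr.
Qed.
#[local] Hint Resolve pr_and : pr.

Lemma pr_or (c d : baire -> (nat -> nat) -> bool) :
  primrec (fun p s => nat_of_bool (c p s)) ->
  primrec (fun p s => nat_of_bool (d p s)) ->
  primrec (fun p s => nat_of_bool (c p s || d p s)).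
Proof.
move=> cP dP; apply: (pr_ext (f := fun p s => nat_of_bool (~~ (~~ c p s && ~~ d p s)))).
  by move=> p s; case: (c p s); case: (d p s).
pr.
Qed.
#[local] Hint Resolve pr_or : pr.

Lemma pr_eq f g : primrec f -> primrec g ->
  primrec (fun p s => nat_of_bool (f p s == g p s)).
Proof.
move=> fP gP; apply: (pr_ext (f := fun p s =>
   nat_of_bool ((f p s <= g p s) && (g p s <= f p s)))).
  by move=> p s; rewrite -eqn_leq.
pr.
Qed.
#[local] Hint Resolve pr_eq : pr.

Lemma pr_sum n g : primrec n -> primrec (fun p s => g p (s 0) (fun i => s i.+1)) ->
  primrec (fun p s => \sum_(i < n p s) g p i s).
Proof.
move=> nP gP.
apply: (pr_ext (f := fun p s => prec 0 (fun m ih => ih + g p m s) (n p s))).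
  by move=> p s; elim: (n p s) => [|m IH] /=; rewrite ?big_ord0 // big_ord_recr IH.
apply: (@pr_prec _ (fun p m ih s => ih + g p m s)); try by pr.
apply: pr_add; first exact: pr_var.
exact: (pr_shift succn gP).
Qed.

Lemma pr_half f : primrec f -> primrec (fun p s => f p s %/ 2).
Proof.
apply: (pr_comp1 (h := fun _ x => x %/ 2)).
(* The floors of m/2 and (m+1)/2 add up to m. *)
apply: (pr_ext (f := fun p s => prec 0 (fun m ih => m - ih) (s 0))).
  by move=> p s; elim: (s 0) => [|n IH] //=; rewrite IH; lia.
apply: (@pr_prec _ (fun _ m ih _ => m - ih)); pr.
Qed.
#[local] Hint Resolve pr_half : pr.

Lemma pr_odd f : primrec f -> primrec (fun p s => nat_of_bool (odd (f p s))).
Proof.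
move=> fP; apply: (pr_ext (f := fun p s => f p s - (f p s %/ 2) * 2)); last by pr.
by move=> p s; rewrite -modn2; lia.
Qed.
#[local] Hint Resolve pr_odd : pr.

Lemma pr_cantor f g : primrec f -> primrec g ->
  primrec (fun p s => cantor_pair (f p s) (g p s)).
Proof. by move=> fP gP; rewrite /cantor_pair; pr. Qed.
#[local] Hint Resolve pr_cantor : pr.

Lemma sum_pick n (F : nat -> nat) i : i < n ->
  (forall j, j < n -> j != i -> F j = 0) -> \sum_(j < n) F j = F i.
Proof.
move=> ltin F0; rewrite (bigD1 (Ordinal ltin)) //= big1 ?addn0 // => j ji.
by apply: F0 => //; move: ji; rewrite -val_eqE.
Qed.

(** * Lists coded by natural numbers *)

(** This is the recursion step of [CodeSeq.code]; it turns list operations into arithmetic on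
    codes. *)
Definition lcons (a c : nat) : nat := 2 ^ a * c.*2.+1.
Definition lhead (c : nat) : nat := seq.head 0 (CodeSeq.decode c).
Definition ltail (c : nat) : nat := CodeSeq.code (behead (CodeSeq.decode c)).
Definition ldrop (c i : nat) : nat := CodeSeq.code (drop i (CodeSeq.decode c)).
Definition lnth (c i : nat) : nat := nth 0 (CodeSeq.decode c) i.

Lemma lconsE a c : lcons a c = CodeSeq.code (a :: CodeSeq.decode c).
Proof. by rewrite /= CodeSeq.decodeK. Qed.

Lemma lhead_lcons a c : lhead (lcons a c) = a.
Proof. by rewrite /lhead lconsE CodeSeq.codeK. Qed.

Lemma ltail_lcons a c : ltail (lcons a c) = c.
Proof. by rewrite /ltail lconsE CodeSeq.codeK /= CodeSeq.decodeK. Qed.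

Lemma lcons_gt a c : a < lcons a c /\ c < lcons a c.
Proof.
have a2 := ltn_expl a (isT : 1 < 2).
have p2 : 0 < 2 ^ a by rewrite expn_gt0.
rewrite /lcons; nia.
Qed.

Lemma lcons_lhead_ltail c : 0 < c -> lcons (lhead c) (ltail c) = c.
Proof.
move=> c0; rewrite lconsE /lhead /ltail CodeSeq.codeK -[RHS]CodeSeq.decodeK.
have : CodeSeq.decode c != [::].
  by apply/eqP => /(congr1 CodeSeq.code); rewrite CodeSeq.decodeK => cE;
    rewrite cE in c0.
by case: (CodeSeq.decode c).
Qed.

Lemma pr_lcons f g : primrec f -> primrec g -> primrec (fun p s =>
  lcons (f p s) (g p s)).
Proof.
move=> fP gP; apply: (pr_ext (f := fun p s => 2 ^ f p s * (2 * g p s).+1)).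
  by move=> p s; rewrite /lcons mul2n.
pr.
Qed.
#[local] Hint Resolve pr_lcons : pr.

(** A bounded search written as a sum: head and tail lie below the code, and by injectivity of
    [lcons] only their term survives. This makes both projections primitive recursive. *)
Lemma code_pick (h : nat -> nat -> nat) c : 0 < c ->
  \sum_(a < c) \sum_(b < c) (if c == lcons a b then h a b else 0) =
    h (lhead c) (ltail c).
Proof.
move=> c0; have cE := lcons_lhead_ltail c0.
have [hc tc] := lcons_gt (lhead c) (ltail c); rewrite cE in hc tc.
apply: (etrans (sum_pick (F := fun a => \sum_(b < c) (if c ==
  lcons a b then h a b else 0)) hc _)).
  move=> a ac ah; rewrite big1 // => b _; case: eqP => // E.
  by move: ah; rewrite {1}E lhead_lcons eqxx.
apply: (etrans (sum_pick (F := fun b => if c == lcons (lhead c) b then h (lhead c) b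
  else 0) tc _)).
  by move=> b bc bt; case: eqP => // E; move: bt; rewrite {1}E ltail_lcons eqxx.
by rewrite cE eqxx.
Qed.

Lemma pr_code_pick (h : nat -> nat -> nat) :
  primrec (fun p s => h (s 0) (s 1)) ->
  primrec (fun p s => \sum_(a < s 0) \sum_(b < s 0) (if s 0 ==
    lcons a b then h a b else 0)).
Proof.
move=> hP.
apply: (@pr_sum _ (fun p a s => \sum_(b < s 0) (if s 0 ==
  lcons a b then h a b else 0))).
  by pr.
apply: (@pr_sum _ (fun p b s => if s 1 == lcons (s 0) b then h (s 0) b else 0)).
  by pr.
apply: pr_if; try by pr.
by apply: (pr_comp2 (h := fun _ x y => h x y)); pr.
Qed.

Lemma pr_lhead f : primrec f -> primrec (fun p s => lhead (f p s)).
Proof.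
apply: (pr_comp1 (h := fun _ x => lhead x)).
have H := @pr_code_pick (fun a _ => a) (pr_var 0).
apply: pr_ext H => p s; case: (posnP (s 0)) => [->|]; first by rewrite big_ord0.
exact: (code_pick (fun a _ => a)).
Qed.
#[local] Hint Resolve pr_lhead : pr.

Lemma pr_ltail f : primrec f -> primrec (fun p s => ltail (f p s)).
Proof.
apply: (pr_comp1 (h := fun _ x => ltail x)).
have H := @pr_code_pick (fun _ b => b) (pr_var 1).
apply: pr_ext H => p s; case: (posnP (s 0)) => [->|]; first by rewrite big_ord0.
exact: (code_pick (fun _ b => b)).
Qed.
#[local] Hint Resolve pr_ltail : pr.

Lemma pr_ldrop f g : primrec f -> primrec g -> primrec (fun p s =>
  ldrop (f p s) (g p s)).
Proof.
apply: (pr_comp2 (h := fun _ x y => ldrop x y)).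
apply: (pr_ext (f := fun p s => prec (s 0) (fun _ ih => ltail ih) (s 1))).
  move=> p s; elim: (s 1) => [|n IH] /=; first by rewrite /ldrop drop0 CodeSeq.decodeK.
  by rewrite IH /ltail /ldrop CodeSeq.codeK -drop1 drop_drop add1n.
apply: (@pr_prec _ (fun _ _ ih _ => ltail ih)); pr.
Qed.
#[local] Hint Resolve pr_ldrop : pr.

Lemma pr_lnth f g : primrec f -> primrec g -> primrec (fun p s => lnth (f p s) (g p s)).
Proof.
move=> fP gP; apply: (pr_ext (f := fun p s => lhead (ldrop (f p s) (g p s)))).
  by move=> p s; rewrite /lhead /ldrop /lnth CodeSeq.codeK -nth0 nth_drop addn0.
pr.
Qed.
#[local] Hint Resolve pr_lnth : pr.

Definition lmkseq (F : nat -> nat) (n : nat) : nat := CodeSeq.code (mkseq F n).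

Lemma lnth_lmkseq F n i : lnth (lmkseq F n) i = if i < n then F i else 0.
Proof.
rewrite /lnth CodeSeq.codeK; case: ltnP => ni; first by rewrite nth_mkseq.
by rewrite nth_default // size_mkseq.
Qed.

Lemma pr_lmkseq n g : primrec n -> primrec (fun p s => g p (s 0) (fun i => s i.+1)) ->
  primrec (fun p s => lmkseq (fun i => g p i s) (n p s)).
Proof.
move=> nP gP.
apply: (pr_ext (f := fun p s =>
  prec 0 (fun m ih => lcons (g p (n p s - m.+1) s) ih) (n p s))).
  move=> p s; move: (n p s) => N; rewrite /lmkseq /mkseq.
  suff H m : m <= N -> prec 0 (fun m ih => lcons (g p (N - m.+1) s) ih) m =
      CodeSeq.code (map (fun i => g p i s) (iota (N - m) m)).
    by rewrite H // subnn.
  elim: m => //= m IH mN; rewrite IH ?(ltnW mN) // lconsE CodeSeq.codeK.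
  by rewrite -subSn // subSS.
apply: (@pr_prec _ (fun p m ih s => lcons (g p (n p s - m.+1) s) ih)); try by pr.
cbv beta; apply: pr_lcons; last by pr.
have nP' := pr_shift (fun i => i.+2) nP.
apply: (@pr_let (fun p x s => g p x (fun i => s i.+2)) (fun p s => n p (fun i =>
  s i.+2) - (s 1).+1)).
  exact: (pr_shift (fun i => if i is j.+1 then j.+3 else 0) gP).
pr.
Qed.

(** Lists serve as memories with default value 0. A list is no longer than its code, so this length
    keeps all old entries and also reaches address [i]; added zeros do no harm. *)
Definition lset (z i v : nat) : nat :=
  lmkseq (fun j => if j == i then v else lnth z j) (i + z).+1.

Lemma size_decode c : size (CodeSeq.decode c) <= c.
Proof.
rewrite -{2}(CodeSeq.decodeK c); elim: (CodeSeq.decode c) => //= a l IH.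
have := (lcons_gt a (CodeSeq.code l)).2; rewrite /lcons; lia.
Qed.

Lemma lnth_lset z i v j : lnth (lset z i v) j = if j == i then v else lnth z j.
Proof.
rewrite lnth_lmkseq; case: ltnP => // zj.
rewrite gtn_eqF; last by lia.
by rewrite /lnth nth_default //; have := size_decode z; lia.
Qed.

Lemma pr_lset f g h : primrec f -> primrec g -> primrec h ->
  primrec (fun p s => lset (f p s) (g p s) (h p s)).
Proof.
apply: (pr_comp3 (h := fun _ x y z => lset x y z)).
apply: (@pr_lmkseq _ (fun p j s => if j == s 1 then s 2 else lnth (s 0) j)); pr.
Qed.
#[local] Hint Resolve pr_lset : pr.

(** The pairs are enumerated along antidiagonals, with the second component increasing. This order
    later schedules the rewriting of the output tape. *)
Lemma cantor_pairS n k : (cantor_pair n k).+1 =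
  if n is m.+1 then cantor_pair m k.+1 else cantor_pair k.+1 0.
Proof.
have triS t : (t.+1 * (t.+1 + 1)) %/ 2 = (t * (t + 1)) %/ 2 + t.+1.
  have -> : t.+1 * (t.+1 + 1) = t.+1 * 2 + t * (t + 1) by lia.
  by rewrite divnMDl // addnC.
case: n => [|n]; rewrite /cantor_pair.
  by rewrite add0n !addn0 triS; lia.
by rewrite addSnnS addnS; lia.
Qed.

Lemma cantor_pair_surj m : exists n k, cantor_pair n k = m.
Proof.
elim: m => [|m [n [k <-]]]; first by exists 0, 0.
by rewrite cantor_pairS; case: n => [|n]; do 2!eexists.
Qed.

Lemma cantor_pair_ge n k : n <= cantor_pair n k /\ k <= cantor_pair n k.
Proof.
rewrite /cantor_pair; split; last by lia.
have : (n + k) * 2 <= (n + k) * (n + k + 1).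
  by case: (n + k) => // t; rewrite leq_mul2l; lia.
move: ((n + k) * (n + k + 1)) => x; lia.
Qed.

Definition unfst (m : nat) : nat :=
  \sum_(n < m.+1) \sum_(k < m.+1) (if m == cantor_pair n k then n : nat else 0).
Definition unsnd (m : nat) : nat :=
  \sum_(n < m.+1) \sum_(k < m.+1) (if m == cantor_pair n k then k : nat else 0).

Lemma cantor_pick (h : nat -> nat -> nat) n k : let m := cantor_pair n k in
  \sum_(a < m.+1) \sum_(b < m.+1) (if m == cantor_pair a b then h a b else 0) = h n k.
Proof.
move=> m; have [nm km] := cantor_pair_ge n k; rewrite -/m in nm km;
  rewrite -ltnS in nm; rewrite -ltnS in km.
apply: (etrans (sum_pick (F := fun a => \sum_(b < m.+1)
    (if m == cantor_pair a b then h a b else 0)) nm _)).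
  move=> a am an; rewrite big1 // => b _.
  by case: eqP => // /cantor_pair_inj[E _]; rewrite E eqxx in an.
apply: (etrans (sum_pick (F := fun b => if m == cantor_pair n b then h n b else 0) km
  _)).
  by move=> b bm bk; case: eqP => // /cantor_pair_inj[_ E]; rewrite E eqxx in bk.
by rewrite eqxx.
Qed.

Lemma unfst_pair n k : unfst (cantor_pair n k) = n.
Proof. exact: (cantor_pick (fun a _ => a)). Qed.

Lemma unsnd_pair n k : unsnd (cantor_pair n k) = k.
Proof. exact: (cantor_pick (fun _ b => b)). Qed.

Lemma pr_unfst f : primrec f -> primrec (fun p s => unfst (f p s)).
Proof.
apply: (pr_comp1 (h := fun _ x => unfst x)).
apply: (@pr_sum _ (fun p a s => \sum_(b < (s 0).+1) (if s 0 ==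
  cantor_pair a b then a else 0))).
  by pr.
apply: (@pr_sum _ (fun p b s => if s 1 == cantor_pair (s 0) b then s 0 else 0)); pr.
Qed.

Lemma pr_unsnd f : primrec f -> primrec (fun p s => unsnd (f p s)).
Proof.
apply: (pr_comp1 (h := fun _ x => unsnd x)).
apply: (@pr_sum _ (fun p a s => \sum_(b < (s 0).+1) (if s 0 ==
  cantor_pair a b then b : nat else 0))).
  by pr.
apply: (@pr_sum _ (fun p b s => if s 1 == cantor_pair (s 0) b then b else 0)); pr.
Qed.
#[local] Hint Resolve pr_unfst pr_unsnd : pr.

Lemma unaryE q i : unary q i =
  if 0 < \sum_(n < i.+1) (i == n + \sum_(m < n.+1) q m) then 2 else 1.
Proof.
rewrite /unary; congr (if _ then _ else _).
apply/existsP/idP => [[n nE]|].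
  by rewrite (bigD1 n) //= nE.
rewrite lt0n sum_nat_eq0 negb_forall => /existsP[n /=].
by rewrite eqb0 negbK => nE; exists n.
Qed.

Lemma pr_unary n g : primrec n -> primrec (fun p s => g p (s 0) (fun i => s i.+1)) ->
  primrec (fun p s => unary (fun i => g p i s) (n p s)).
Proof.
move=> nP gP; apply: pr_ext => [p s|]; first by rewrite unaryE.
apply: pr_if; try by pr.
apply: pr_leq; first exact: pr_const.
apply: (@pr_sum _ (fun p a s => nat_of_bool (n p s == a + \sum_(m < a.+1) g p m s))).
  by pr.
apply: pr_eq; first exact: (pr_shift succn nP).
apply: pr_add; first by pr.
apply: (@pr_sum _ (fun p m s => g p m (fun i => s i.+1))); first by pr.
exact: (pr_shift (fun i => if i is j.+1 then j.+2 else 0) gP).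
Qed.

(** * Machines with a primitive recursive index *)

Definition index (k : nat) (P : seq instr) (m : nat) : nat :=
  CodeSeq.code (k :: map CodeSeq.code (init_rules k (size P) m ++ chain k P m)).

(** The parameter enters the table only through state numbers, the first two entries of a rule. The
    remainder [C] of each rule is a constant, and the chain is built by recursion on [m]. *)
Lemma pr_index k P : primrec (fun _ s => index k P (s 0)).
Proof.
pose C rd tr := CodeSeq.code (drop 2 (mkrule k 0 0 rd tr)).
have mkE q q' rd tr : CodeSeq.code (mkrule k q q' rd tr) = lcons q (lcons q' (C rd tr)).
  by [].
pose R j x := lcons ((size P).+2 + j) (lcons ((size P).+1 + j)
  (C (chain_read k x) (fun j => (chain_read k x j, if j == 1 then Right else Stay)))).
pose chainc m := prec (CodeSeq.code (map CodeSeq.code (prog_rules k P)))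
  (fun j ih => lcons (R j (1, 0)) (lcons (R j (1, 1)) (lcons (R j (2, 0)) (lcons (R j
    (2, 1)) ih)))) m.
have chainE m : CodeSeq.code (map CodeSeq.code (chain k P m)) = chainc m.
  elim: m => // m IH; rewrite chainS map_cat /chainc [prec _ _ _]/= -/(chainc m) -IH.
  by rewrite /R -!mkE.
pose I m a := lcons 0 (lcons ((size P).+1 + m) (C (fun j => if j == 0 then a else 0)
  (fun j => (if (j == 0) || (j == k.+1) then 0 else 1, Stay)))).
apply: (@pr_ext (fun _ s => lcons k (lcons (I (s 0) 1) (lcons (I (s 0) 2) (chainc (s
  0)))))).
  by move=> _ s; rewrite -chainE /I -!mkE.
rewrite /I; do 3!(apply: pr_lcons; first by pr).
apply: (@pr_prec _ (fun _ j ih _ => lcons (R j (1, 0)) (lcons (R j (1, 1)) (lcons (R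
  j (2, 0)) (lcons (R j (2, 1)) ih))))); rewrite /R; pr.
Qed.

(** The interface for everything that follows: machines that write an output use the parameter 0,
    while questions to the jump are encoded in [m]. *)
Lemma machine_family (b : bool) (phi : baire -> nat -> nat -> nat) :
  primrec (fun p s => phi p (s 0) (s 1)) ->
  exists g : nat -> nat, primrec (fun _ s => g (s 0)) /\
  forall m, [/\ b = false -> one_way (nth_machine (g m)),
    forall p, (forall n, phi p m n < 3 + b) -> exists nu : nat -> nat,
      (forall t, (out_head (nth_machine (g m)) p t, out (nth_machine (g m)) p t) =
         emits (mkseq (phi p m) (nu t))) /\
      (forall N, exists T, forall t, T <= t -> N <= nu t) &
    forall p, halts (nth_machine (g m)) p <-> exists n, 3 + b <= phi p m n].
Proof.
move=> [e eE]; pose k := maxn 1 (cregs (main_cmd b e)).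
have [k0 kP] : 0 < k /\ cregs (main_cmd b e) <= k by rewrite /k; lia.
exists (index k (compile (main_cmd b e) 0)); split; first exact: pr_index.
move: k k0 kP => k k0 kP m; rewrite /index nth_machine_code -/(param_machine _ _ _).
split=> [b0|p ok|p].
- exact: main_one_way.
- exact: (main_out eE).
- exact: (main_halts eE).
Qed.

(** * A universal simulation *)

(* A configuration is coded by a list [z] that has the state at address 0, the
   head position of tape [j] at [cantor_pair 0 j.+1], and cell [x] of tape
   [j > 0] at [cantor_pair j x].  The list [u] contains the first cells of the
   input tape, and [c] codes a rule. *)
Definition rd_sim (u z j : nat) : nat :=
  if j == 0 then lnth u (lnth z (cantor_pair 0 j.+1))
  else lnth z (cantor_pair j (lnth z (cantor_pair 0 j.+1))).

Definition match_sim (u k z c : nat) : bool :=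
  (lnth c 0 == lnth z 0) &&
  (\sum_(j < k.+2) nat_of_bool (lnth c (3 * j + 2) != rd_sim u z j) == 0).

(** The first applicable rule is returned as its code plus one, so that 0 can mean that there is
    none. A missing entry reads as 0, which also codes a rule; hence the test with [ldrop]. The
    index itself bounds the number of rules. *)
Definition find_sim (u i z : nat) : nat :=
  prec 0 (fun l ih =>
    if (ih == 0) && (ldrop i l.+1 != 0) && match_sim u (lhead i) z (lnth i l.+1)
    then (lnth i l.+1).+1 else ih) i.

Definition move_sim (d h : nat) : nat :=
  if d == 0 then h else if d == 1 then h.-1 else h.+1.

Definition upd_sim (c z j : nat) : nat :=
  lset (if j == 0 then z
        else lset z (cantor_pair j (lnth z (cantor_pair 0 j.+1))) (lnth c (3 * j + 3)))
    (cantor_pair 0 j.+1)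
    (move_sim (lnth c (3 * j + 4)) (lnth z (cantor_pair 0 j.+1))).

Definition apply_sim (c k z : nat) : nat :=
  lset (prec z (fun j ih => upd_sim c ih j) k.+2) 0 (lnth c 1).

Definition step_sim (u i z : nat) : nat :=
  if find_sim u i z == 0 then z else apply_sim (find_sim u i z).-1 (lhead i) z.

(** The start value 0 codes the empty list, which reads as initial state, heads at 0 and blank
    tapes. *)
Definition sim (u i t : nat) : nat := prec 0 (fun _ z => step_sim u i z) t.

Lemma pr_rd_sim f g h : primrec f -> primrec g -> primrec h ->
  primrec (fun p s => rd_sim (f p s) (g p s) (h p s)).
Proof. by move=> fP gP hP; rewrite /rd_sim; pr. Qed.
#[local] Hint Resolve pr_rd_sim : pr.

Lemma pr_match_sim f g h l : primrec f -> primrec g -> primrec h -> primrec l ->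
  primrec (fun p s => nat_of_bool (match_sim (f p s) (g p s) (h p s) (l p s))).
Proof.
apply: (pr_comp4 (h := fun _ x y z w => nat_of_bool (match_sim x y z w))).
apply: pr_and; first by pr.
apply: pr_eq; last by pr.
apply: (@pr_sum _ (fun p j s => nat_of_bool (lnth (s 3) (3 * j + 2) !=
  rd_sim (s 0) (s 2) j))); pr.
Qed.
#[local] Hint Resolve pr_match_sim : pr.

Lemma pr_find_sim f g h : primrec f -> primrec g -> primrec h ->
  primrec (fun p s => find_sim (f p s) (g p s) (h p s)).
Proof.
apply: (pr_comp3 (h := fun _ x y z => find_sim x y z)).
apply: (@pr_prec _ (fun p l ih s =>
    if (ih == 0) && (ldrop (s 1) l.+1 != 0) && match_sim (s 0) (lhead (s 1)) (s 2)
      (lnth (s 1) l.+1)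
    then (lnth (s 1) l.+1).+1 else ih)); pr.
Qed.
#[local] Hint Resolve pr_find_sim : pr.

Lemma pr_upd_sim f g h : primrec f -> primrec g -> primrec h ->
  primrec (fun p s => upd_sim (f p s) (g p s) (h p s)).
Proof. by move=> fP gP hP; rewrite /upd_sim /move_sim; pr. Qed.
#[local] Hint Resolve pr_upd_sim : pr.

Lemma pr_apply_sim f g h : primrec f -> primrec g -> primrec h ->
  primrec (fun p s => apply_sim (f p s) (g p s) (h p s)).
Proof.
apply: (pr_comp3 (h := fun _ x y z => apply_sim x y z)).
apply: pr_lset; try by pr.
apply: (@pr_prec _ (fun p j ih s => upd_sim (s 0) ih j)); pr.
Qed.
#[local] Hint Resolve pr_apply_sim : pr.

Lemma pr_sim f g h : primrec f -> primrec g -> primrec h ->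
  primrec (fun p s => sim (f p s) (g p s) (h p s)).
Proof.
apply: (pr_comp3 (h := fun _ x y z => sim x y z)).
apply: (@pr_prec _ (fun p _ z s => step_sim (s 0) (s 1) z)); rewrite /step_sim; pr.
Qed.
#[local] Hint Resolve pr_sim : pr.

Lemma find_prec (Q : nat -> bool) (cs : seq nat) N :
  prec 0 (fun l ih => if (ih == 0) && (l < size cs) && Q (nth 0 cs l)
    then (nth 0 cs l).+1 else ih) N =
  if [seq c <- take N cs | Q c] is c :: _ then c.+1 else 0.
Proof.
elim: N => [|N IH] /=; first by rewrite take0.
rewrite IH; case: (ltnP N (size cs)) => Ns; last first.
  by rewrite andbF /= !take_oversize // (leq_trans Ns).
rewrite (take_nth 0) // filter_rcons andbT.
by case: [seq c <- _ | _] => [|c l] /=; case: (Q _).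
Qed.

Lemma ldrop_neq0 c i : (ldrop c i != 0) = (i < size (CodeSeq.decode c)).
Proof.
rewrite /ldrop; have := size_drop i (CodeSeq.decode c).
case: (drop _ _) => [|a l] /= sz.
  by apply/esym/negbTE; rewrite -leqNgt -subn_eq0 -sz.
have -> : i < size (CodeSeq.decode c) by rewrite -subn_gt0 -sz.
by rewrite -lt0n muln_gt0 expn_gt0.
Qed.

Definition simrel (k : nat) (c : config k) (z : nat) : Prop :=
  [/\ state c = lnth z 0,
      forall j : 'I_k.+2, Defs.head c j = lnth z (cantor_pair 0 j.+1) &
      forall j : 'I_k.+2, j != ord0 -> forall x, tape c j x = lnth z (cantor_pair j x)].

Lemma match_simP k u (c : config k) z s :
  simrel c z -> tape c ord0 (Defs.head c ord0) = lnth u (Defs.head c ord0) ->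
  match_sim u k z s = ((decode_rule k (CodeSeq.decode s)).1 == (state c, scan c)).
Proof.
move=> [cstate lhead tp] inp; rewrite /match_sim /decode_rule xpair_eqE /= -cstate;
  congr andb.
have rdE (j : 'I_k.+2) : rd_sim u z j = tnth (scan c) j.
  rewrite tnth_mktuple /rd_sim -lhead; case: (eqVneq j ord0) => [->|j0].
    by rewrite inp.
  by rewrite ifN // tp.
rewrite sum_nat_eq0; apply/forallP/eqP => /= [E|E j].
  apply: eq_from_tnth => j; have := E j; rewrite eqb0 negbK rdE => /eqP <-.
  by rewrite tnth_mktuple.
by rewrite eqb0 negbK rdE -E tnth_mktuple.
Qed.

Lemma cantor_pair00 : cantor_pair 0 0 = 0. Proof. by []. Qed.

Lemma cantor_pair_eq n k n' k' : (cantor_pair n k == cantor_pair n' k') = (n ==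
  n') && (k == k').
Proof.
by apply/eqP/andP => [/cantor_pair_inj[-> ->]//|[/eqP -> /eqP ->]].
Qed.

Lemma apply_simP k (c : config k) z s : simrel c z ->
  simrel (act (decode_rule k (CodeSeq.decode s)).2.1 (decode_rule k (CodeSeq.decode
    s)).2.2 c)
    (apply_sim s k z).
Proof.
move=> [cstate lhead tp].
(* The memory after the tapes below [n] have been treated. Different tapes use different addresses,
   so tape [n] still shows its old head and cells. *)
pose zz n := prec z (fun j ih => upd_sim s ih j) n.
have Hh n j : lnth (zz n) (cantor_pair 0 j.+1) =
    if j < n then move_sim (lnth s (3 * j + 4)) (lnth z (cantor_pair 0 j.+1))
    else lnth z (cantor_pair 0 j.+1).
  elim: n j => // n IH j; rewrite [zz _]/= /upd_sim lnth_lset cantor_pair_eq /=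
    eqSS ltnS -/(zz n).
  have headE : lnth (if n == 0 then zz n else lset (zz n) (cantor_pair n
      (lnth (zz n) (cantor_pair 0 n.+1))) (lnth s (3 * n + 3))) (cantor_pair 0 j.+1)
      = lnth (zz n) (cantor_pair 0 j.+1).
    by case: eqP => // n0; rewrite lnth_lset cantor_pair_eq; case: (n) n0.
  rewrite headE IH; case: (eqVneq j n) => [->|jn].
    by rewrite IH ltnn leqnn.
  by rewrite [j <= n]leq_eqVlt (negbTE jn).
have Ht n j x : 0 < j -> lnth (zz n) (cantor_pair j x) =
    if (j < n) && (x == lnth z (cantor_pair 0 j.+1)) then lnth s (3 * j + 3)
    else lnth z (cantor_pair j x).
  move=> j0; elim: n => // n IH; rewrite [zz _]/= /upd_sim lnth_lset cantor_pair_eq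
    -/(zz n).
  rewrite (gtn_eqF j0) /= ltnS; case: (eqVneq n 0) => [n0|n0].
    by rewrite IH n0 ltn0 leqn0 (gtn_eqF j0).
  rewrite lnth_lset cantor_pair_eq Hh ltnn IH [j <= n]leq_eqVlt;
    case: (eqVneq j n) => [->|jn] //=.
  by rewrite ltnn.
split.
- by rewrite /apply_sim lnth_lset.
- move=> j; rewrite /apply_sim -/(zz k.+2) lnth_lset.
  have -> : (cantor_pair 0 j.+1 == 0) = false by rewrite -[X in _ ==
    X]cantor_pair00 cantor_pair_eq.
  rewrite Hh ltn_ord /= lhead tnth_mktuple /= /move_sim.
  by rewrite -/(lnth _ _); case: (lnth s (3 * j + 4)) => [|[|d]].
- move=> j j0 x; rewrite /apply_sim -/(zz k.+2) lnth_lset.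
  have j0' : 0 < j by rewrite lt0n; move: j0; rewrite -val_eqE.
  have -> : (cantor_pair j x == 0) = false by rewrite -[X in _ ==
    X]cantor_pair00 cantor_pair_eq (gtn_eqF j0').
  by rewrite Ht // ltn_ord /= j0 lhead tp // tnth_mktuple.
Qed.

Lemma lookup_find u k cs (c : config k) z : simrel c z ->
  tape c ord0 (Defs.head c ord0) = lnth u (Defs.head c ord0) ->
  [seq r.2 | r <- [seq decode_rule k (CodeSeq.decode x) | x <- cs]
           & r.1 == (state c, scan c)] =
  [seq (decode_rule k (CodeSeq.decode x)).2 | x <- cs & match_sim u k z x].
Proof.
move=> rel inp; rewrite filter_map -map_comp; congr map.
by apply: eq_filter => x; rewrite (match_simP _ rel inp).
Qed.

Lemma find_simE u i z : find_sim u i z =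
  if [seq c <- behead (CodeSeq.decode i) | match_sim u (lhead i) z c] is c :: _
  then c.+1 else 0.
Proof.
rewrite -[in RHS](take_oversize (n := i) (s := behead _)); last first.
  by rewrite size_behead (leq_trans (leq_pred _)) // size_decode.
rewrite -find_prec /find_sim; congr prec.
apply/funext => l; apply/funext => ih; rewrite ldrop_neq0 size_behead /lnth nth_behead.
by congr (if _ && _ && _ then _ else _); lia.
Qed.

Lemma step_simP u i (c : config (work_tapes (nth_machine i))) z : simrel c z ->
  tape c ord0 (Defs.head c ord0) = lnth u (Defs.head c ord0) ->
  (step c = None <-> find_sim u i z = 0) /\ simrel (odflt c (step c)) (step_sim u i z).
Proof.
move=> rel inp; rewrite /step_sim find_simE.
have -> : step c = if [seq (decode_rule _ (CodeSeq.decode x)).2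
      | x <- behead (CodeSeq.decode i) & match_sim u (lhead i) z x]
    is (s, acts) :: _ then Some (act s acts c) else None.
  by rewrite -(lookup_find _ rel inp).
case: [seq c <- _ | _] => [|x l] //=.
split=> //; exact: apply_simP.
Qed.

Definition cells (p : baire) (t : nat) : nat := lmkseq (unary p) t.

Lemma run_input M p t x : tape (run M p t) ord0 x = unary p x.
Proof.
elim: t x => [|t IH] x; first by [].
rewrite runS /step; case: [seq _ | _ <- _ & _] => [|[s acts] l] //=; exact: IH.
Qed.

Lemma run_head M p t j : Defs.head (run M p t) j <= t.
Proof.
elim: t => [|t IH] //; rewrite runS /step.
case: [seq _ | _ <- _ & _] => [|[s acts] l] /=; first exact: leqW.
by case: (tnth acts j).2 => /=; lia.
Qed.

Lemma lnth_cells p t x : x < t -> lnth (cells p t) x = unary p x.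
Proof. by move=> xt; rewrite lnth_lmkseq xt. Qed.

Lemma sim_input p i t t' : t' < t ->
  tape (run (nth_machine i) p t') ord0
    (Defs.head (run (nth_machine i) p t') ord0) =
  lnth (cells p t) (Defs.head (run (nth_machine i) p t') ord0).
Proof.
move=> t't; rewrite run_input lnth_cells //.
by apply: leq_ltn_trans t't; exact: run_head.
Qed.

(** A head advances at most one cell per step, so the first [t] input cells suffice for [t]
    steps. *)
Lemma sim_run p i t t' : t' <= t ->
  simrel (run (nth_machine i) p t') (sim (cells p t) i t').
Proof.
elim: t' => [_|t' IH t't].
  by split=> [|j|j /negbTE j0 x] /=; rewrite ?j0 /lnth nth_nil.
have rel := IH (ltnW t't).
have [_ H] := step_simP rel (sim_input p i t't).
exact: H.
Qed.

(** Entry 0 of an index is the number of work tapes, which locates the output tape at number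
    [(lhead i).+1]. *)
Definition out_sim (u i t x : nat) : nat :=
  lnth (sim u i t) (cantor_pair (lhead i).+1 x).
Definition head_sim (u i t : nat) : nat :=
  lnth (sim u i t) (cantor_pair 0 (lhead i).+2).
Definition stop_sim (u i t : nat) : bool := find_sim u i (sim u i t) == 0.

Lemma out_simE p i t t' x : t' <= t ->
  out_sim (cells p t) i t' x = out (nth_machine i) p t' x.
Proof.
by move=> /(sim_run p i)[_ _ tp]; rewrite /out tp.
Qed.

Lemma head_simE p i t t' : t' <= t ->
  head_sim (cells p t) i t' = out_head (nth_machine i) p t'.
Proof. by move=> /(sim_run p i)[_ hdE _]; rewrite /out_head hdE. Qed.

(** The inequality is strict because the halting test still reads the input symbol at time [t'],
    possibly in cell [t']. *)
Lemma stop_simE p i t t' : t' < t ->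
  stop_sim (cells p t) i t' <-> step (run (nth_machine i) p t') = None.
Proof.
move=> t't; have rel := sim_run p i (ltnW t't).
have [stopE _] := step_simP rel (sim_input p i t't).
by rewrite stopE /stop_sim; split=> /eqP.
Qed.

Lemma pr_cells f : primrec f -> primrec (fun p s => cells p (f p s)).
Proof.
apply: (pr_comp1 (h := fun p x => cells p x)).
apply: (@pr_lmkseq _ (fun p j _ => unary p j)); pr.
Qed.
#[local] Hint Resolve pr_cells : pr.

Lemma pr_out_sim f g h l : primrec f -> primrec g -> primrec h -> primrec l ->
  primrec (fun p s => out_sim (f p s) (g p s) (h p s) (l p s)).
Proof. by move=> fP gP hP lP; rewrite /out_sim; pr. Qed.

Lemma pr_head_sim f g h : primrec f -> primrec g -> primrec h ->
  primrec (fun p s => head_sim (f p s) (g p s) (h p s)).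
Proof. by move=> fP gP hP; rewrite /head_sim; pr. Qed.

Lemma pr_stop_sim f g h : primrec f -> primrec g -> primrec h ->
  primrec (fun p s => nat_of_bool (stop_sim (f p s) (g p s) (h p s))).
Proof. by move=> fP gP hP; rewrite /stop_sim; pr. Qed.
#[local] Hint Resolve pr_out_sim pr_head_sim pr_stop_sim : pr.

(** * Limits and unary codes *)

Lemma limitP p q : limit p q <->
  forall k, exists N, forall n, N <= n -> component p n k = q k.
Proof.
rewrite /limit /=; split=> [/(pointwise_cvgP (U := nat) (V := nat)) cv k|cv].
  have /(discrete_cvg (X := nat))[N _ NP] := cv k.
  by exists N => n Nn; exact: (NP n Nn).
apply/(pointwise_cvgP (U := nat) (V := nat)) => k.
apply/(discrete_cvg (X := nat)).
by have [N NP] := cv k; exists N.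
Qed.

Lemma unary_ext q q' i : (forall j, j <= i -> q j = q' j) -> unary q i = unary q' i.
Proof.
move=> qq'; rewrite !unaryE; congr (if 0 < _ then 2 else 1).
apply: eq_bigr => n _; congr (nat_of_bool (i == n + _)).
apply: eq_bigr => m _; apply: qq'.
by have := ltn_ord n; have := ltn_ord m; lia.
Qed.

Lemma eventually_all (P : nat -> nat -> Prop) i :
  (forall k, exists N, forall n, N <= n -> P n k) ->
  exists N, forall n, N <= n -> forall k, k <= i -> P n k.
Proof.
move=> H; elim: i => [|i [N NP]].
  by have [N NP] := H 0; exists N => n Nn k; rewrite leqn0 => /eqP ->; apply: NP.
have [N' NP'] := H i.+1; exists (maxn N N') => n; rewrite geq_max => /andP[Nn N'n] k.
by rewrite leq_eqVlt => /predU1P[->|ki]; [apply: NP' | apply: NP].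
Qed.

(* [unary_dec w L m] is the number of 1s between the [m]-th 2 and its predecessor
   in the tape content [w], cut off after [L] cells. *)
Definition count2 (w : nat -> nat) (x : nat) : nat :=
  \sum_(y < x) nat_of_bool (w y == 2).

Definition unary_dec (w : nat -> nat) (L m : nat) : nat :=
  \sum_(x < L) nat_of_bool ((w x == 1) && (count2 w x == m)).

(** The cell at which the code of entry [m] begins: the earlier entries and their [m] separators
    precede it. *)
Definition block (q : nat -> nat) (m : nat) : nat := m + \sum_(j < m) q j.

Lemma blockS q m : block q m.+1 = (block q m + q m).+1.
Proof. by rewrite /block big_ord_recr /=; lia. Qed.

Lemma block_le q m n : m <= n -> block q m <= block q n.
Proof.
by move=> /subnK <-; elim: (n - m) => // d IH; rewrite addSn blockS; lia.
Qed.

Lemma unary_block q m d : d <= q m ->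
  unary q (block q m + d) = if d == q m then 2 else 1.
Proof.
move=> dm; rewrite /unary; congr (if _ then _ else _).
have posE n : n + \sum_(j < n.+1) q j = block q n + q n.
  by rewrite /block big_ord_recr /=; lia.
apply/existsP/eqP => [[n /eqP]|->].
  rewrite posE; case: (ltngtP n m) => [nm|mn|-> /addnI//] E.
    by have := block_le q nm; rewrite blockS; lia.
  by have := block_le q mn; rewrite blockS; lia.
have mB : m < (block q m + q m).+1 by rewrite /block; lia.
by exists (Ordinal mB); rewrite /= posE.
Qed.

Lemma block_decomp q L : exists m d, d <= q m /\ L = block q m + d.
Proof.
elim: L => [|L [m [d [dm ->]]]]; first by exists 0, 0; rewrite /block big_ord0.
move: dm; rewrite leq_eqVlt => /predU1P[->|dm].
  by exists m.+1, 0; rewrite blockS addn0.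
by exists m, d.+1; rewrite addnS.
Qed.

Lemma count2S w x : count2 w x.+1 = count2 w x + (w x == 2).
Proof. by rewrite /count2 big_ord_recr. Qed.

Lemma unary_decS w L m : unary_dec w L.+1 m = unary_dec w L m + ((w L == 1) &&
  (count2 w L == m)).
Proof. by rewrite /unary_dec big_ord_recr. Qed.

Lemma unary_dec_block q m d : d <= q m ->
  count2 (unary q) (block q m + d) = m /\
  forall j, unary_dec (unary q) (block q m + d) j =
    if j < m then q j else if j == m then d else 0.
Proof.
elim: m d => [|m IHm] d; elim: d => [|d IHd] dm.
- by rewrite /block big_ord0 /count2 /unary_dec big_ord0; split=> // j;
  rewrite big_ord0; case: eqP.
- have [c e] := IHd (ltnW dm); rewrite addnS count2S c.
  split=> [|j]; last rewrite unary_decS e c.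
    by rewrite unary_block ?ltn_eqF // ltnW.
  by rewrite unary_block ?(ltnW dm) // (ltn_eqF dm); case: j => [|j]; rewrite /=
    ?addn0 ?addn1.
- have [c e] := IHm (q m) (leqnn _); rewrite blockS addn0 count2S c.
  split=> [|j]; last rewrite unary_decS e c.
    by rewrite unary_block // eqxx addn1.
  rewrite unary_block // eqxx addn0 ltnS; case: (ltngtP j m) => jm //.
    by case: ifP.
  by rewrite jm.
- have [c e] := IHd (ltnW dm); rewrite addnS count2S c.
  split=> [|j]; last rewrite unary_decS e c.
    by rewrite unary_block ?ltn_eqF ?addn0 // ltnW.
  rewrite unary_block ?(ltnW dm) // (ltn_eqF dm) /=.
  case: (ltngtP j m.+1) => jm /=; by [rewrite addn0|rewrite addn0|rewrite addn1].
Qed.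

Lemma unary_decK q L m : m < count2 (unary q) L -> unary_dec (unary q) L m = q m.
Proof.
have [n [d [dn ->]]] := block_decomp q L.
by have [-> ->] := unary_dec_block dn => ->.
Qed.

Lemma count2_le w x y : x <= y -> count2 w x <= count2 w y.
Proof.
by move=> /subnK <-; elim: (y - x) => // d IH; rewrite addSn count2S; lia.
Qed.

Lemma count2_block q m : count2 (unary q) (block q m) = m.
Proof. by have [+ _] := @unary_dec_block q m 0 isT; rewrite addn0. Qed.

Lemma count2_ext w w' L : (forall x, x < L -> w x = w' x) -> count2 w L = count2 w' L.
Proof. by move=> ww'; apply: eq_bigr => x _; rewrite ww'. Qed.

Lemma unary_dec_ext w w' L m : (forall x, x < L -> w x = w' x) -> unary_dec w L m =
  unary_dec w' L m.
Proof.
move=> ww'; apply: eq_bigr => x _; rewrite ww' // (@count2_ext w w') // => y yx.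
by apply: ww'; apply: ltn_trans yx (ltn_ord x).
Qed.

(** Once separator [m] has been passed, later 1s see a larger count of separators and contribute
    nothing. *)
Lemma unary_dec_stable w L L' m : m < count2 w L -> L <= L' -> unary_dec w L' m =
  unary_dec w L m.
Proof.
move=> mL /subnK <-; elim: (L' - L) => // d IH; rewrite addSn unary_decS IH.
have mL' : m < count2 w (d + L) by apply: leq_trans mL _; apply: count2_le; lia.
by rewrite (gtn_eqF mL') andbF addn0.
Qed.

Lemma pr_count2 n g : primrec n -> primrec (fun p s => g p (s 0) (fun i => s i.+1)) ->
  primrec (fun p s => count2 (fun i => g p i s) (n p s)).
Proof.
move=> nP gP; apply: (@pr_sum _ (fun p y s => nat_of_bool (g p y s == 2))) => //.
by apply: pr_eq => //; exact: pr_const.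
Qed.

Lemma pr_unary_dec n m g : primrec n -> primrec m ->
  primrec (fun p s => g p (s 0) (fun i => s i.+1)) ->
  primrec (fun p s => unary_dec (fun i => g p i s) (n p s) (m p s)).
Proof.
move=> nP mP gP; apply: (@pr_sum _ (fun p x s =>
  nat_of_bool ((g p x s == 1) && (count2 (fun i => g p i s) x == m p s)))) => //.
apply: pr_and; first by apply: pr_eq => //; exact: pr_const.
apply: pr_eq; last exact: (pr_shift succn mP).
apply: (@pr_count2 (fun p s => s 0) (fun p i s => g p i (fun i => s i.+1)));
  first by pr.
exact: (pr_shift (fun i => if i is j.+1 then j.+2 else 0) gP).
Qed.

Lemma emits_mkseqS f n : emits (mkseq f n.+1) = emit (emits (mkseq f n)) (f n).
Proof. by rewrite mkseqS emits_rcons. Qed.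

Lemma computable_emits (F : pfun baire baire) (phi : baire -> nat -> nat) :
  primrec (fun p s => phi p (s 0)) ->
  (forall p q, F p q -> (forall n, phi p n < 3) /\
     forall i, exists N, forall n, N <= n -> i < (emits (mkseq (phi p) n)).1 /\
       (emits (mkseq (phi p) n)).2 i = unary q i) ->
  computable_fun F.
Proof.
move=> phiP H.
have phiP' : primrec (fun p s => phi p (s 1)).
  by apply: (pr_comp1 (h := fun p x => phi p x)) => //; pr.
have [g [_ /(_ 0)[ow outP _]]] := @machine_family false (fun p _ n => phi p n) phiP'.
exists (nth_machine (g 0)); first exact: ow.
move=> p q Fpq i; have [phi3 E] := H p q Fpq.
have [nu [nuE unb]] := outP p phi3.
have [N NP] := E i; have [T TP] := unb N; exists T.
  have := nuE T; case: (NP (nu T) (TP T (leqnn T))) => + _.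
  by case: (emits _) => h o /= ih [-> _].
have := nuE T; case: (NP (nu T) (TP T (leqnn T))) => _.
by case: (emits _) => h o /= oi [_ ->].
Qed.

Lemma emits_unary q n : emits (mkseq (unary q) n) =
  (n, fun i => if i < n then unary q i else 0).
Proof.
elim: n => [|n IH]; first by rewrite /emits.
rewrite emits_mkseqS IH /emit /=; congr pair.
  by case: (unary12 q n) => ->.
apply/funext => i; rewrite ltnS; case: (ltngtP i n) => [||->] //.
by rewrite /osym; case: (unary12 q n) => ->.
Qed.

Lemma computable_primrec (F : pfun baire baire) (w : baire -> baire) :
  primrec (fun p s => w p (s 0)) -> (forall p q, F p q -> q = w p) ->
  computable_fun F.
Proof.
move=> wP H; apply: (@computable_emits _ (fun p n => unary (w p) n)).
  apply: (@pr_unary (fun p s => s 0) (fun p i _ => w p i)); first by pr.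
  exact: wP.
move=> p q /H ->; split=> [n|i]; first by case: (unary12 (w p) n) => ->.
by exists i.+1 => n ni; rewrite emits_unary /= ni.
Qed.

(** * Limit computability through approximations *)

Definition approx (F : pfun baire baire) : Prop :=
  exists2 c : baire -> nat -> nat -> nat, primrec (fun p s => c p (s 0) (s 1)) &
    forall p q, F p q -> forall i, exists N, forall n, N <= n -> c p n i = unary q i.

Lemma limit_computable_approx F : limit_computable_fun F -> approx F.
Proof.
move=> [M MP]; have [i0 iE] := nth_machine_surj M.
exists (fun p n i => out_sim (cells p n) i0 n i); first by pr.
move=> p q Fpq i; have [t0 H] := MP p q Fpq i; exists t0 => n nt.
by rewrite out_simE // iE H.
Qed.

(* In stage [s], which consists of the [s.+1] pairs with sum [s], an even [s] writes
   the cells 0, ..., s and an odd [s] moves the head back to cell 0. *)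
Definition rewrite_act (c : nat -> nat -> nat) (n : nat) : nat :=
  let s := unfst n + unsnd n in
  if odd s then 3 else if c s (unsnd n) == 1 then 1 else 2.

Lemma rewrite_pair c a k : rewrite_act c (cantor_pair a k) =
  if odd (a + k) then 3 else if c (a + k) k == 1 then 1 else 2.
Proof. by rewrite /rewrite_act unfst_pair unsnd_pair. Qed.

(** An even stage s leaves the head at cell s+1. The odd stage s+1 makes s+2 moves to the left, the
    last of them at cell 0 without effect, so the next even stage starts at cell 0. *)
Lemma rewrite_head c a k :
  (emits (mkseq (rewrite_act c) (cantor_pair a k))).1 = if odd (a + k) then a else k.
Proof.
move nE: (cantor_pair a k) => n; elim: n a k nE => [|n IH] a k.
  have [ge1 ge2] := cantor_pair_ge a k => E; rewrite E in ge1 ge2.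
  have a0 : a = 0 by lia.
  have k0 : k = 0 by lia.
  by rewrite a0 k0.
have [a' [k' nE]] := cantor_pair_surj n => E.
rewrite emits_mkseqS /emit /= (IH _ _ nE) -nE rewrite_pair.
move: E; rewrite -nE cantor_pairS; case: a' {nE} => [|a'] /cantor_pair_inj[-> ->].
  by rewrite add0n addn0 /=; case: (odd k') => //=; case: ifP.
by rewrite addnS addSn /=; case: (odd _) => //=; case: ifP.
Qed.

Lemma rewrite_cell (c : nat -> nat -> nat) (i v N : nat) : (v == 1) || (v == 2) ->
  (forall n, N <= n -> c n i = v) ->
  exists n0, forall n, n0 <= n -> (emits (mkseq (rewrite_act c) n)).2 i = v.
Proof.
(* [S] is even, so that its stage writes; at least [N], so that the value written is final; and at
   least [i], so that cell [i] is reached. *)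
move=> v12 cv; pose S := (N + i).*2.
have vE : (if v == 1 then 1 else 2) = v by case/orP: v12 => /eqP ->.
have step a k : S <= a + k -> (emits (mkseq (rewrite_act c) (cantor_pair a k))).2 i = v
    \/ a + k = S /\ k = i ->
    (emits (mkseq (rewrite_act c) (cantor_pair a k).+1)).2 i = v.
  move=> Sak; rewrite emits_mkseqS /emit /= rewrite_head rewrite_pair.
  case: (boolP (odd (a + k))) => odd_ak.
    case=> [->|[E _]]; first by case: eqP.
    by move: odd_ak; rewrite E odd_double.
  case: (eqVneq i k) => [ik|ik].
    have Ni : N <= a + k by rewrite /S in Sak; lia.
    by move=> _ /=; rewrite -{2}ik cv // vE /osym v12.
  by case=> // -[_ E]; rewrite E eqxx in ik.
have iS : S - i + i = S by rewrite subnK // /S; lia.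
exists (cantor_pair (S - i) i).+1 => n /subnK <-.
suff [] : (emits (mkseq (rewrite_act c) (n - (cantor_pair (S - i) i).+1
    + (cantor_pair (S - i) i).+1))).2 i = v /\
  exists a k, S <= a + k /\ cantor_pair a k = n - (cantor_pair (S - i) i).+1
    + (cantor_pair (S - i) i).+1 by [].
elim: (n - _) => [|d [IH [a [k [Sak E]]]]].
  split; first by apply: step; [rewrite iS | right; rewrite iS].
  rewrite add0n cantor_pairS; case E: (S - i) => [|a]; do 2!eexists; split;
    try reflexivity; lia.
rewrite addSn -E; split; first by apply: step => //; left; rewrite E.
by rewrite cantor_pairS; case: a Sak {E} => [|a] Sak; do 2!eexists; split;
  try reflexivity; lia.
Qed.

Lemma approx_limit_computable F : approx F -> limit_computable_fun F.
Proof.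
move=> [c cP H].
have actP : primrec (fun p s => rewrite_act (c p) (s 1)).
  apply: (pr_comp1 (h := fun p n => rewrite_act (c p) n)); last by pr.
  apply: pr_if; first by pr.
    exact: pr_const.
  apply: pr_if; try exact: pr_const.
  apply: pr_eq; last exact: pr_const.
  by apply: (pr_comp2 (h := c)); pr.
have [g [_ /(_ 0)[_ outP _]]] := @machine_family true (fun p _ n =>
  rewrite_act (c p) n) actP.
exists (nth_machine (g 0)) => p q Fpq i.
have [|nu [nuE unb]] := outP p.
  by move=> n; rewrite /rewrite_act; case: ifP => // _; case: ifP.
have [N NP] := H p q Fpq i.
have v12 : (unary q i == 1) || (unary q i == 2) by case: (unary12 q i) => ->.
have [n0 n0P] := rewrite_cell v12 NP.
have [T TP] := unb n0; exists T => t Tt.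
by have := nuE t; have := n0P _ (TP t Tt); case: (emits _) => h o /= <- [_ ->].
Qed.

Lemma approx_primrec_limit F : approx F ->
  exists2 w : baire -> baire, primrec (fun p s => w p (s 0)) &
    forall p q, F p q -> limit (w p) q.
Proof.
move=> [c cP H].
exists (fun p m => unary_dec (c p (unfst m)) (unfst m) (unsnd m)).
  apply: (@pr_unary_dec _ _ (fun p i s => c p (unfst (s 0)) i)); try by pr.
  by apply: (pr_comp2 (h := c)); pr.
move=> p q Fpq; apply/limitP => k.
have [N NP] := eventually_all (block q k.+1) (H p q Fpq).
(* Beyond the first bound the cells up to the separator of entry [k] are final; beyond the second
   they are among the [n] cells that are decoded. *)
exists (maxn N (block q k.+1)) => n; rewrite geq_max => /andP[Nn Bn].
rewrite /component unfst_pair unsnd_pair.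
have cE x : x < block q k.+1 -> c p n x = unary q x by move=> /ltnW; exact: NP.
have kB : k < count2 (c p n) (block q k.+1) by rewrite (count2_ext cE) count2_block.
by rewrite (unary_dec_stable kB Bn) (unary_dec_ext _ cE) unary_decK // count2_block.
Qed.

Lemma out_head_le M p t u : one_way M -> t <= u ->
  out_head M p t <= out_head M p u /\
  forall i, i < out_head M p t -> out M p u i = out M p t i.
Proof.
move=> ow /subnK <-; elim: (u - t) => [|d [IH1 IH2]]; first by split.
rewrite addSn /out_head /out runS /step.
case E: [seq r.2 | r <- table M & _] => [|[s acts] l] /=; first by split.
have notL : (tnth acts ord_max).2 <> Left.
  have : all (fun x : nat * (work_tapes M).+2.-tuple (nat * move) =>
      if (tnth x.2 ord_max).2 is Left then false else true) ((s, acts) :: l).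
    rewrite -E all_map all_filter; apply: sub_all ow => r /=.
    by case: (tnth _ _).2 => //; rewrite implybT.
  by rewrite /=; case: (tnth _ _).2.
have hle : Defs.head (run M p (d + t)) ord_max <=
    move_head (tnth acts ord_max).2 (Defs.head (run M p (d + t)) ord_max).
  by case: (tnth acts ord_max).2 notL => //= _; exact: leqnSn.
split; first exact: leq_trans IH1 hle.
move=> i ih; rewrite ltn_eqF ?andbF; first exact: IH2.
exact: leq_trans ih IH1.
Qed.

(** The definition provides one time per cell. As the head never returns, the content is the same at
    every time when the head is beyond the cell. *)
Lemma computable_out M F : one_way M ->
  (forall p q, F p q -> forall i, exists2 t, i < out_head M p t & out M p t i =
    unary q i) ->
  forall p q, F p q ->
    (forall t i, i < out_head M p t -> out M p t i = unary q i) /\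
    forall i, exists N, forall t, N <= t -> i < out_head M p t.
Proof.
move=> ow H p q Fpq; split=> [t i it|i]; last first.
  have [N iN _] := H p q Fpq i; exists N => t Nt.
  by apply: leq_trans iN _; have [] := out_head_le p ow Nt.
have [t' it' <-] := H p q Fpq i.
case: (leqP t t') => [tt'|/ltnW t't].
  by have [_ ->] := out_head_le p ow tt'.
by have [_ ->] := out_head_le p ow t't.
Qed.

Lemma precS a g n : prec a g n.+1 = g n (prec a g n).
Proof. by []. Qed.

(* Among the components whose entry [k] is complete in the first [L] cells of [w],
   the last one below [s] provides the value; its number tends to infinity with
   [s]. *)
Definition last_limit (w : nat -> nat) (L s k : nat) : nat :=
  prec 0 (fun m ih => if cantor_pair m k < count2 w L then unary_dec w L (cantor_pair
    m k)
                      else ih) s.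

Lemma computable_limit_approx F : computable_fun F -> approx (Defs.pcomp limit F).
Proof.
move=> [M ow MP]; have [i0 iE] := nth_machine_surj M.
pose W p s := out_sim (cells p s) i0 s; pose L p s := head_sim (cells p s) i0 s.
exists (fun p s i => unary (last_limit (W p s) (L p s) s) i).
  have WP : primrec (fun p s => W p (s 0) (s 1)) by rewrite /W; pr.
  have LP : primrec (fun p s => L p (s 0)) by rewrite /L; pr.
  apply: (@pr_unary _ (fun p k s => last_limit (W p (s 0)) (L p (s 0)) (s 0) k));
    first by pr.
  apply: (@pr_prec _ (fun p m ih s => if cantor_pair m (s 0) < count2 (W p (s 1)) (L
    p (s 1))
     then unary_dec (W p (s 1)) (L p (s 1)) (cantor_pair m (s 0)) else ih)); try by pr.
  have LP3 : primrec (fun p s => L p (s 3)) by apply: (pr_comp1 (h := L)); pr.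
  have WP3 : primrec (fun p s => W p (s 4) (s 0)) by apply: (pr_comp2 (h := W)); pr.
  apply: pr_if; last by pr.
    by apply: pr_leq; [pr | apply: (@pr_count2 _ (fun p i s => W p (s 3) i))].
  by apply: (@pr_unary_dec _ _ (fun p i s => W p (s 3) i)); pr.
move=> p q [q' Fpq' /limitP lim_q] i.
have [fin prog] := computable_out ow MP Fpq'.
have WE s x : x < L p s -> W p s x = unary q' x.
  by rewrite /W /L head_simE // out_simE // iE; exact: fin.
suff : exists N, forall s, N <= s -> forall k, k <= i ->
    last_limit (W p s) (L p s) s k = q k.
  by move=> [N NP]; exists N => s /NP; exact: unary_ext.
apply: (@eventually_all (fun s k => last_limit (W p s) (L p s) s k = q k)) => k.
have [N NP] := lim_q k.
have [T TP] := prog (block q' (cantor_pair N k).+1).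
(* Beyond [T] entry [k] of component [N] is complete, and [N < s] includes it in the scan. Later
   components can only replace its value by the same limit value. *)
exists (maxn T N.+1) => s; rewrite geq_max => /andP[Ts Ns].
have complete : cantor_pair N k < count2 (W p s) (L p s).
  rewrite (count2_ext (WE s)) -{1}(count2_block q' (cantor_pair N k)).
  have := count2_block q' (cantor_pair N k).+1.
  have : block q' (cantor_pair N k).+1 <= L p s.
    by rewrite /L head_simE // iE ltnW // TP.
  by move=> /(count2_le (unary q')) le E; rewrite count2_block; rewrite E in le.
have decE m : cantor_pair m k < count2 (W p s) (L p s) ->
    unary_dec (W p s) (L p s) (cantor_pair m k) = q' (cantor_pair m k).
  by rewrite (count2_ext (WE s)) (unary_dec_ext _ (WE s)); exact: unary_decK.
move: (W p s) (L p s) complete decE => w l complete decE.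
rewrite /last_limit -(subnK Ns); elim: (s - N.+1) => [|d IH].
  by rewrite add0n precS; cbv beta; rewrite complete decE //; exact: (NP N).
rewrite addSn precS; cbv beta; case: ifP => [/decE ->|_]; last exact: IH.
by apply: NP; lia.
Qed.

(** * Computations on the jump *)

Definition jump_sim (p : baire) (s : nat) : baire :=
  fun j => stop_sim (cells p s.+1) j s.

(** Halting shows after finitely many steps and persists; a machine that never halts has the correct
    bit at every stage. *)
Lemma jump_sim_lim p j : exists N, forall s, N <= s -> jump_sim p s j = turing_jump p j.
Proof.
rewrite /turing_jump /jump_sim; case: asboolP => [[t stop]|norun].
  exists t => s ts; have -> //: stop_sim (cells p s.+1) j s.
  by apply/stop_simE => //; rewrite -(subnK ts) stop_run.
exists 0 => s _; case E: (stop_sim _ _ _) => //.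
by case: norun; exists s; apply/(stop_simE p j (ltnSn s)).
Qed.

(** Finite use: the part of the jump that is read before cell [i] becomes final is guessed correctly
    from some stage on. The guess need not be a jump, but a one-way machine protects its output on
    every input. *)
Lemma computable_jump_approx F : computable_fun F ->
  forall G : pfun baire baire, (forall p q, G p q -> F (turing_jump p) q) -> approx G.
Proof.
move=> [M ow MP] G GF; have [i0 iE] := nth_machine_surj M.
exists (fun p s i => out_sim (cells (jump_sim p s) s) i0 s i).
  apply: pr_out_sim; try by pr.
  apply: (@pr_lmkseq _ (fun p x s => unary (jump_sim p (s 0)) x)); first by pr.
  apply: (@pr_unary _ (fun p j s => jump_sim p (s 1) j)); first by pr.
  by rewrite /jump_sim; pr.
move=> p q /GF Fq i.
have [t it tE] := MP _ _ Fq i.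
(* [t] steps read only the first [t] cells, and these depend only on the entries up to [t]. *)
have [N NP] := eventually_all t (jump_sim_lim p).
exists (maxn N t) => s; rewrite geq_max => /andP[Ns ts].
rewrite out_simE // iE.
have cellsE : cells (jump_sim p s) t = cells (turing_jump p) t.
  congr CodeSeq.code; apply/eq_in_map => x; rewrite mem_iota add0n => /andP[_ xt].
  by apply: unary_ext => j jx; apply: NP => //; lia.
have headE : out_head M (jump_sim p s) t = out_head M (turing_jump p) t.
  by rewrite -iE -!(head_simE _ _ (leqnn t)) cellsE.
have outE : out M (jump_sim p s) t i = out M (turing_jump p) t i.
  by rewrite -iE -!(out_simE _ _ _ (leqnn t)) cellsE.
have [_ ->] := out_head_le (jump_sim p s) ow ts; first by rewrite outE.
by rewrite headE.
Qed.

(* For a sequence [r] of bits, the cell where block [j] begins tells the value [r j]. *)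
Definition bit_pos (r : baire) (j : nat) : nat :=
  prec 0 (fun _ x => x + (3 - unary r x)) j.

(** Bit 0 has the code 2 and bit 1 the code 1 2. So the first cell u of a block reveals its length 3
    - u and leads to the next block. *)
Lemma unary_bit_pos r j : (forall n, r n <= 1) ->
  unary r (bit_pos r j) = if r j == 0 then 2 else 1.
Proof.
move=> r1.
suff -> : bit_pos r j = block r j.
  by have := @unary_block r j 0 isT; rewrite addn0 eq_sym.
elim: j => [|j IH]; first by rewrite /block big_ord0.
rewrite /bit_pos [prec _ _ _]/= -/(bit_pos r j) IH blockS.
have := @unary_block r j 0 isT; rewrite addn0 => ->.
by have := r1 j; case: (r j) => [|[|]] //= _; lia.
Qed.

Lemma approx_computable_jump F : approx F -> computable_fun (Defs.pcomp F jump_inv).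
Proof.
move=> [c cP H].
(* The value 4 is the least one that is no action when [b] is true; it signals a stage at which
   stability is refuted. *)
pose psi p m n := if (lhead (ltail m) <= n) && (c p n (lhead m) !=
  ltail (ltail m)) then 4 else 0.
have psiP : primrec (fun p s => psi p (s 0) (s 1)).
  apply: pr_if; try by pr.
  apply: pr_and; first by pr.
  by apply: pr_not; apply: pr_eq; [apply: (pr_comp2 (h := c)); pr | pr].
have [g [gP gE]] := machine_family true psiP.
(* The machine with parameter [(i, t, v)] halts iff [c p n i != v] for some
   [n >= t]; so the jump decides whether the [i]-th cell is [v] from [t] on. *)
pose ask (r : baire) i t v := unary r (bit_pos r (g (lcons i (lcons t v)))).
(* The answer 2 is bit 0: the search for a refutation does not halt. *)
have askE p i t v : reflect (forall n, t <= n -> c p n i = v)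
    (ask (turing_jump p) i t v == 2).
  rewrite /ask unary_bit_pos; last by move=> n; rewrite /turing_jump; case: ifP.
  rewrite /turing_jump; have [_ _ /(_ p) haltE] := gE (lcons i (lcons t v)).
  have psiE n : psi p (lcons i (lcons t v)) n = if (t <= n) && (c p n i !=
    v) then 4 else 0.
    by rewrite /psi lhead_lcons ltail_lcons lhead_lcons ltail_lcons.
  case: asboolP => [halt|nohalt] /=; constructor.
    have /haltE[n] := halt; rewrite psiE; case: ifP => // /andP[tn cv] _ E.
    by rewrite E // eqxx in cv.
  move=> n tn; apply/eqP/negPn/negP => cv; apply: nohalt; apply/haltE.
  by exists n; rewrite psiE tn cv.
pose next r z := if ask r (lhead z) (ltail z) 1 == 2 then lcons (lhead z).+1 0
  else if ask r (lhead z) (ltail z) 2 == 2 then lcons (lhead z).+1 0 else lcons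
    (lhead z) (ltail z).+1.
(* [Z r n] is the pair of the cell to be written next and of the candidate [t]
   beyond which its value is tested for stability. *)
pose Z r n := prec (lcons 0 0) (fun _ z => next r z) n.
pose phi r n := let z := Z r n in
  if ask r (lhead z) (ltail z) 1 == 2 then 1 else if ask r (lhead z) (ltail z) 2 ==
    2 then 2 else 0.
have askP f h k : primrec f -> primrec h -> primrec k ->
    primrec (fun r s => ask r (f r s) (h r s) (k r s)).
  move=> fP hP kP; apply: pr_cell.
  apply: (@pr_prec _ (fun r _ x _ => x + (3 - unary r x))); try by pr.
  by apply: (pr_comp1 (h := fun _ x => g x)); [exact: gP | pr].
have ZP : primrec (fun r s => Z r (s 0)).
  apply: (@pr_prec _ (fun r _ z _ => next r z)); try by pr.
  by do 2!(apply: pr_if; [by apply: pr_eq; [apply: askP; pr | pr] | by pr |]); pr.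
apply: (@computable_emits _ phi).
  by do 2!(apply: pr_if; [by apply: pr_eq; [apply: askP; pr | pr] | by pr |]); pr.
move=> r q [p <- Fpq]; split=> [n|i].
  by rewrite /phi; case: ifP => // _; case: ifP.
set r' := turing_jump p; set E := fun n => emits (mkseq (phi r') n).
have cE := H p q Fpq.
have stable j t v n : ask r' j t v == 2 -> v = unary q j.
  move=> /askE cv; have [N NP] := cE j.
  by rewrite -(NP (maxn N t)) ?leq_maxl // cv // leq_maxr.
have ZS n : Z r' n.+1 = next r' (Z r' n) by [].
(* The output head stands on the cell that is being decided, and all cells before it are final. *)
have inv n : (E n).1 = lhead (Z r' n) /\ forall j, j < lhead (Z r' n) -> (E n).2 j =
  unary q j.
  elim: n => [|n [IH1 IH2]]; first by rewrite /Z /= lhead_lcons.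
  have symE v : v = 1 \/ v = 2 -> v = unary q (lhead (Z r' n)) -> phi r' n = v ->
    Z r' n.+1 = lcons (lhead (Z r' n)).+1 0 ->
    (E n.+1).1 = lhead (Z r' n.+1) /\ forall j, j < lhead (Z r' n.+1) ->
      (E n.+1).2 j = unary q j.
    move=> v12 vE phiE ZE; rewrite /E emits_mkseqS -/(E n) phiE ZE lhead_lcons /emit
      /= IH1.
    split=> [|j]; first by case: v12 => ->.
    rewrite ltnS leq_eqVlt; case: eqP => [->|_ /= jz]; last exact: IH2.
    by rewrite /osym -vE; case: v12 => ->.
  case: (boolP (ask r' (lhead (Z r' n)) (ltail (Z r' n)) 1 == 2)) => a1.
    apply: (symE 1); [by left | exact: stable a1 | by rewrite /phi /= a1 |].
    by rewrite ZS /next a1.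
  case: (boolP (ask r' (lhead (Z r' n)) (ltail (Z r' n)) 2 == 2)) => a2.
    apply: (symE 2); [by right | exact: stable a2 | by rewrite /phi /=
      (negbTE a1) a2 |].
    by rewrite ZS /next (negbTE a1) a2.
  have -> : Z r' n.+1 = lcons (lhead (Z r' n)) (ltail (Z r' n)).+1.
    by rewrite ZS /next (negbTE a1) (negbTE a2).
  rewrite lhead_lcons /E emits_mkseqS -/(E n).
  have -> : phi r' n = 0 by rewrite /phi /= (negbTE a1) (negbTE a2).
  by rewrite /emit /=; split=> // j jz; case: eqP => _; rewrite -IH2.
have mono n d : lhead (Z r' n) <= lhead (Z r' (d + n)).
  elim: d => // d IH; apply: leq_trans IH _.
  rewrite addSn ZS /next.
  by do 2!(case: ifP => _; first by rewrite lhead_lcons leqnSn); rewrite lhead_lcons.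
have visit j : exists N, Z r' N = lcons j 0.
  elim: j => [|j [N ZN]]; first by exists 0.
  have [T TP] := cE j.
  (* Each failed pair of tests raises the candidate by one, so the cell is settled at the latest
     when the candidate is the modulus [T] of convergence. *)
  have next_or d : (exists N', Z r' N' = lcons j.+1 0) \/ Z r' (d + N) = lcons j d.
    elim: d => [|d [|Zd]]; [by right | by left |].
    have : Z r' (d + N).+1 = next r' (lcons j d) by rewrite ZS Zd.
    rewrite /next lhead_lcons ltail_lcons.
    case: ifP => _; first by move=> ?; left; eexists; eassumption.
    case: ifP => _; first by move=> ?; left; eexists; eassumption.
    by right.
  have [//|ZT] := next_or T; exists (T + N).+1.
  have -> : Z r' (T + N).+1 = next r' (lcons j T) by rewrite ZS ZT.
  rewrite /next lhead_lcons ltail_lcons.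
  by case: (unary12 q j) => qj; [rewrite ifT | rewrite [X in if _ then _ else X]ifT
    ?if_same] => //;
    apply/askE => n Tn; rewrite TP.
have [N ZN] := visit i.+1; exists N => n /subnK Nn; have [-> E2] := inv n.
have iZ : i < lhead (Z r' n).
  by have := mono N (n - N); rewrite ZN lhead_lcons Nn.
by rewrite E2.
Qed.

Theorem theorem4p5 (X Y : rep_space) (f : X -> set Y) :
  (@limit_computable X Y f <-> @computable X (lim_space Y) f) /\
  (@computable X (lim_space Y) f <-> @computable (jump_space X) Y f).
Proof.
have lim_of F : approx F -> @realizes X Y f F -> @computable X (lim_space Y) f.
  move=> /approx_primrec_limit[w wP wlim] Ff.
  pose G := @PFun baire baire (fun p q => q = w p) (fun p q q' e e' =>
    etrans e (esym e')).
  exists G; first by apply: (computable_primrec wP).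
  move=> p x px fx; have [q [y [Fpq qy fxy]]] := Ff p x px fx.
  by exists (w p), y; split=> //; exists q => //; exact: wlim.
have approx_of : @computable X (lim_space Y) f ->
    exists2 F, approx F & @realizes X Y f F.
  move=> [F /computable_limit_approx Fa Ff]; exists (Defs.pcomp limit F) => //.
  move=> p x px fx; have [q' [y [Fpq' [q lq qy] fxy]]] := Ff p x px fx.
  by exists q, y; split=> //; exists q'.
have lim_approx : @limit_computable X Y f -> exists2 F, approx F & @realizes X Y f F.
  by move=> [F /limit_computable_approx Fa Ff]; exists F.
split; split.
- by case/lim_approx=> F; exact: lim_of.
- by case/approx_of=> F /approx_limit_computable Fc Ff; exists F.
- case/approx_of=> F /approx_computable_jump Fc Ff; 
    exists (Defs.pcomp F jump_inv) => //.
  move=> r x [p pr px] fx; have [q [y [Fpq qy fxy]]] := Ff p x px fx.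
  by exists q, y; split=> //; exists p.
- move=> [F Fc Ff].
  (* Precomposing with the jump turns a name of x in X into one in [jump_space X]; the
     noncomputability of the jump is absorbed by the approximation. *)
  pose J := @PFun baire baire (fun p r => turing_jump p = r)
    (fun p r r' e e' => etrans (esym e) e').
  apply: (lim_of (Defs.pcomp F J)).
    by apply: (computable_jump_approx Fc) => p q [_ <-].
  move=> p x px fx.
  have [|q [y [Fq qy fxy]]] := Ff (turing_jump p) x _ fx; first by exists p.
  by exists q, y; split=> //; exists (turing_jump p).
Qed.
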